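(* Let $\beta > 0$, $t < c_q(1-2\beta)$ and let $p$ be a positive real number satisfying $$q^{n\left( -\frac{1}{2}+\frac{t(C_q-1)}{2}\right)} \leq p \leq 1.$$ Let $B$ be a random subset of $\mathbb{F}_{q}^{n}$ with the events $x \in B$ being independent with probability $\mathbb{P}(x \in B) = p$. Then, with probability $1 - o_{n \to \infty}(1)$ we have that $$f_{3}(B) \ll pq^{n\left(1-t +2\beta\right)}.$$ In particular, for all $\epsilon>0$, there exists $\delta(\epsilon,q):=\delta >0$ such that if $B$ is a random subset of $\mathbb{F}_{q}^{n}$ with the events $x \in B$ being independent with probability $\mathbb{P}(x \in B) = p$, where $p=q^{n(-\frac{1}{2}+\epsilon)}$, then with probability $1 - o_{n \to \infty}(1)$, \[ f_3(B) \ll |B|^{1-\delta}. \]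
   Context: Here $q$ is a prime power and $n$ a positive integer. A $k$-term arithmetic progression is a set $\{x,x+d,\dots,x+(k-1)d\}$, nontrivial if $d\neq 0$; for a set $A$, $f_3(A)$ denotes the size of the largest subset of $A$ containing no nontrivial three-term arithmetic progression. The constant $c_q>0$ is defined by \[ q^{1-c_q} = \inf_{0 < y < 1} \frac {1+y+ \dots +y^{q-1}}{y^{(q-1)/3}}, \] (so that $f_3(\mathbb F_q^n) \leq q^{n(1-c_q)}$ up to constants, by Ellenberg–Gijswijt), and $C_q := 1+\frac{1}{c_q}$. The notation $X \ll Y$ means $X \leq cY$ for some absolute constant $c>0$. *)

(* Defs.v *)
From HB Require Import structures.
From mathcomp Require Export all_boot all_order all_algebra.
From mathcomp Require Export all_classical all_reals all_analysis.

Set Implicit Arguments.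
Unset Strict Implicit.
Unset Printing Implicit Defensive.

Export Order.TTheory GRing.Theory Num.Theory.
Export numFieldNormedType.Exports.

Local Open Scope ring_scope.

Section ArithmeticProgressions.
Variable V : finZmodType.

(* As in the source, a progression is the set of its terms and it is
   nontrivial when d != 0, even if some of its terms coincide; so in
   characteristic 2 every two-element set {x, x + d} is a nontrivial
   three-term progression. *)
Definition arith_prog (k : nat) (x d : V) : {set V} :=
  ([set (x + d *+ i)%R | i : 'I_k])%SET.

Definition ap_free (k : nat) (S : {set V}) : bool :=
  [forall x : V, forall d : V, (d != 0) ==> ~~ (arith_prog k x d \subset S)].

Definition max_ap_free (k : nat) (A : {set V}) : nat :=
  \max_(S : {set V} | (S \subset A) && ap_free k S) #|S|.

End ArithmeticProgressions.

Notation f3 := (max_ap_free 3).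

Local Open Scope classical_set_scope.

Section RandomSubsets.
Context {R : realType} {d : measure_display} {T : measurableType d}.
Variable P : probability T R.

Definition mutually_independent (I : finType) (E : I -> set T) : Prop :=
  forall J : {set I},
    P (\bigcap_(i in [set` J]) E i) = (\prod_(i in J) P (E i))%E.

Definition binomial_random_subset (V : finType) (p : R) (B : T -> {set V}) :
    Prop :=
  [/\ forall x : V, measurable [set w | x \in B w],
      forall x : V, P [set w | x \in B w] = p%:E
    & mutually_independent (fun x : V => [set w | x \in B w])].

End RandomSubsets.

Section Constants.
Variables (R : realType) (q : nat).

Definition EG_inf : R :=
  inf [set (\sum_(i < q) y ^+ i) / y `^ ((q%:R - 1) / 3) | y in `]0, 1[ ].

(* The solution c of q^(1 - c) = EG_inf; see powR_c_ below. *)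
Definition c_ : R := 1 - ln EG_inf / ln q%:R.

Definition C_ : R := 1 + c_^-1.

Lemma powR_c_ : (1 < q)%N -> q%:R `^ (1 - c_) = EG_inf.
Proof.
move=> q1.
have EG_gt0 : 0 < EG_inf.
  apply: (@lt_le_trans _ _ 1) => //; apply: lb_le_inf.
    by exists ((\sum_(i < q) 2^-1 ^+ i) / 2^-1 `^ ((q%:R - 1) / 3));
      exists 2^-1 => //=; rewrite in_itv /= invr_gt0 ltr0n /= invf_lt1 ?ltr1n.
  move=> z [y /=]; rewrite in_itv /= => /andP[y0 y1] <-.
  rewrite ler_pdivlMr ?powR_gt0// mul1r.
  apply: (@le_trans _ _ 1).
    rewrite -[leRHS](powRr0 y); apply: ger_powR; first by rewrite y0 ltW.
    by rewrite divr_ge0// subr_ge0 ler1n ltnW.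
  rewrite -(prednK (ltnW q1)) big_ord_recl expr0 lerDl.
  by apply: sumr_ge0 => i _; rewrite exprn_ge0 // ltW.
have q_gt1 : 1 < q%:R :> R by rewrite ltr1n.
have lnq : ln q%:R != 0 :> R by rewrite gt_eqF // ln_gt0.
rewrite /c_ opprB addrC subrK /powR gt_eqF ?(lt_trans _ q_gt1) //.
by rewrite divfK // lnK // posrE.
Qed.

End Constants.

(* Main.v *)
Require Import Defs.
From mathcomp Require Import finfield.
From mathcomp Require Import ring lra zify.

Set Implicit Arguments.
Unset Strict Implicit.
Unset Printing Implicit Defensive.

(** Every AP-free set lies in one of few containers, each of size at most
    [N^(1-t+beta)] with [N = q^n]; a union bound over the containers then controls
    the AP-free subsets of the random set.

    Containers: let A span e progressions on v points, and let I be an AP-free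
    subset of A. Greedily picking s points of I of largest degree as first terms,
    then s points of I as middle terms, forbids a set of last terms; either it or
    the set of points whose degree exceeds that of the best point of I carries a
    positive proportion of the progressions and misses I, as soon as
    [s^2 e > 10 v^3]. Removing it divides e by at least 20/19, so O(n) rounds
    suffice, each costing a factor [N^O(s)].

    Supersaturation: a set of density u pulled back along a random affine map
    [F_q^m -> F_q^n] with [q^m ~ u^(-1/c)] exceeds the Ellenberg-Gijswijt bound on
    average, hence spans at least [a u^(1+1/c) N^2] progressions. So a container
    with few progressions is small, and [s ~ p N^(1-t)] is admissible
    under the hypothesis on p, because [c <= 1/3].

    The Ellenberg-Gijswijt bound is proved by slice rank. *)

(** The container step needs a linear triple system: any two terms of a progression determine the
    third. In characteristic 2 the equation [x - 2y + z = 0] leaves the middle term free, so that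
    case is separate; there AP-free sets have at most one point. Capping the degrees of the picked
    triples ensures that a set touching few triples of [A] also touches few picked ones, so that
    shares can be compared between the two systems. The containers number [N^O(sn)], and the union
    bound has to beat this. Of the [2 beta] in the exponent, one [beta] goes into the container
    size; the other pays for the count, whose logarithm is of order [s n^2]. With [r = 1/c],
    supersaturation makes [s^2 e / v^3] at least of order [s^2 w^(r-2) / N] at density [w]. As
    [r >= 3], it is enough to look at [w = N^(beta - t)], where the lower bound on [p] makes this a
    positive power of [N]. *)

Local Open Scope nat_scope.

(** * Containers for linear triple systems *)

Section Greedy.
Variables (V : finType) (St : Type).
Variables (upd : St -> V -> St) (score : St -> V -> nat) (pot : St -> nat).
Hypothesis pot_upd : forall st u, (pot st + score st u <= pot (upd st u)).
Hypothesis score_upd : forall st u x, (score (upd st u) x <= score st x).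

Fixpoint greedy_state (st : St) (us : seq V) : St :=
  if us is u :: us' then upd (greedy_state st us') u else st.

(* The picks maximise the score over I, so each of them raises the potential
   by at least the final score of any element of I. *)
Lemma greedy_picks (st : St) (I : {set V}) (x0 : V) (s : nat) :
  x0 \in I ->
  exists us : seq V, [/\ size us = s, all (mem I) us &
    forall x, x \in I ->
      (s * score (greedy_state st us) x <= pot (greedy_state st us))].
Proof.
move=> x0I; elim: s => [|s [us [sz usI Hus]]]; first by exists [::]; split.
pose u := [arg max_(x > x0 in I) score (greedy_state st us) x].
have [uI Hu] : u \in I /\ forall x, x \in I ->
    (score (greedy_state st us) x <= score (greedy_state st us) u).
  by rewrite /u; case: arg_maxnP => // i iI Hi; split.
exists (u :: us); split=> /=; [by rewrite sz | by rewrite usI andbT|].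
move=> x xI; apply: leq_trans (pot_upd _ u).
rewrite mulSn addnC; apply: leq_add.
  by apply: leq_trans (Hus x xI); rewrite leq_mul2l score_upd orbT.
exact: leq_trans (score_upd _ _ _) (Hu x xI).
Qed.

End Greedy.

Section CardFibers.
Variables (T V : finType).
Implicit Types (X : {set T}) (D : {set V}) (f : T -> V).

Lemma card_fibers X f D :
  #|[set t in X | f t \in D]| = \sum_(z in D) #|[set t in X | f t == z]|.
Proof.
rewrite -sum1_card (partition_big f (mem D)) /=; last first.
  by move=> t; rewrite inE => /andP[].
apply: eq_bigr => z zD; rewrite -sum1_card; apply: eq_bigl => t.
by rewrite !inE; case: eqP => [->|]; rewrite ?andbF // zD !andbT.
Qed.

Lemma sum_fibers X f D (g : V -> nat) :
  \sum_(t in X | f t \in D) g (f t) =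
  \sum_(z in D) #|[set t in X | f t == z]| * g z.
Proof.
rewrite (partition_big f (mem D)) /=; last by move=> t /andP[].
apply: eq_bigr => z zD; rewrite -sum1_card big_distrl /=.
apply: eq_big => [t|t /andP[_ /eqP->]]; last by rewrite mul1n.
by rewrite !inE; case: eqP => [->|]; rewrite ?andbF // zD !andbT.
Qed.

End CardFibers.

Lemma leq_sqr_sum (V : finType) (D : {set V}) (f : V -> nat) :
  ((\sum_(z in D) f z) ^ 2 <= #|D| * \sum_(z in D) f z ^ 2).
Proof.
rewrite -(leq_pmul2l (isT : (0 < 2))).
have -> : (2 * (#|D| * \sum_(z in D) f z ^ 2) =
    \sum_(x in D) \sum_(y in D) (f x ^ 2 + f y ^ 2)).
  rewrite [RHS](eq_bigr (fun x => #|D| * f x ^ 2 + \sum_(y in D) f y ^ 2)).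
    by rewrite big_split /= sum_nat_const -big_distrr /=; lia.
  by move=> x _; rewrite big_split /= sum_nat_const.
rewrite -mulnn big_distrlr /= big_distrr /=; apply: leq_sum => x _.
rewrite big_distrr /=; apply: leq_sum => y _.
exact: (nat_Cauchy (f x) (f y)).1.
Qed.

Section Containers.
Variables (V : finType) (E : V -> V -> V -> bool).
Hypothesis E_inj1 : forall x x' y z, E x y z -> E x' y z -> x = x'.
Hypothesis E_inj2 : forall x y y' z, E x y z -> E x y' z -> y = y'.
Hypothesis E_inj3 : forall x y z z', E x y z -> E x y z' -> z = z'.
Implicit Types (A C D I : {set V}) (L X : {set V * V * V}).

Definition triples A : {set V * V * V} :=
  [set t | [&& t.1.1 \in A, t.1.2 \in A, t.2 \in A & E t.1.1 t.1.2 t.2]].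

Definition indep I :=
  forall x y z, x \in I -> y \in I -> z \in I -> ~~ E x y z.

Lemma triplesS C A : C \subset A -> triples C \subset triples A.
Proof.
move=> /fintype.subsetP CA; apply/fintype.subsetP => t; rewrite !inE.
by case/and4P=> ? ? ? ->; rewrite !CA.
Qed.

Lemma triples_indep I : indep I -> triples I = finset.set0.
Proof.
move=> indI; apply/setP => t; rewrite !inE; apply/negP => /and4P[? ? ?].
by apply/negP; apply: indI.
Qed.

Lemma card_triples_setD A D (f : V * V * V -> V) :
  (forall t, t \in triples A -> f t \in D -> t \notin triples (A :\: D)) ->
  #|triples (A :\: D)| + #|[set t in triples A | f t \in D]| <= #|triples A|.
Proof.
move=> HD; rewrite -(cardsID [set t | f t \in D] (triples A)) addnC leq_add //.
  by apply: subset_leq_card; apply/fintype.subsetP => t; rewrite !inE.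
apply: subset_leq_card; apply/fintype.subsetP => t tT.
have tA : t \in triples A by apply: fintype.subsetP tT; apply/triplesS/subsetDl.
rewrite inE tA andbT inE; apply/negP => ftD.
by move: tT; apply/negP; apply: HD.
Qed.

(** * One container step *)

Section OneStep.
Variables (A : {set V}) (s : nat).
Let v := #|A|.
Let e := #|triples A|.

Definition deg2 X y := #|[set t in X | t.1.2 == y]|.
Definition deg3 X z := #|[set t in X | t.2 == z]|.

(* [L] collects triples whose first entry has been picked; the degree caps keep
   its degrees proportional to those of [triples A]. *)
Definition link L x : {set V * V * V} :=
  [set t in triples A | [&& t.1.1 == x, t \notin L,
     deg2 L t.1.2 * v <= s * deg2 (triples A) t.1.2 &
     deg3 L t.2 * v <= s * deg3 (triples A) t.2]].

Definition links := greedy_state (fun L x => L :|: link L x) finset.set0.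

Lemma links_nil : links [::] = finset.set0. Proof. by []. Qed.

Lemma links_cons u us : links (u :: us) = links us :|: link (links us) u.
Proof. by []. Qed.

Lemma deg2_set0 y : deg2 finset.set0 y = 0.
Proof. by apply/eqP; rewrite cards_eq0; apply/eqP/setP => t; rewrite !inE. Qed.

Lemma deg2S X X' y : X \subset X' -> deg2 X y <= deg2 X' y.
Proof.
move=> /fintype.subsetP XX'; apply: subset_leq_card; apply/fintype.subsetP => t.
by rewrite !inE => /andP[/XX' -> ->].
Qed.

Lemma deg3_set0 y : deg3 finset.set0 y = 0.
Proof. by apply/eqP; rewrite cards_eq0; apply/eqP/setP => t; rewrite !inE. Qed.

Lemma deg3S X X' y : X \subset X' -> deg3 X y <= deg3 X' y.
Proof.
move=> /fintype.subsetP XX'; apply: subset_leq_card; apply/fintype.subsetP => t.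
by rewrite !inE => /andP[/XX' -> ->].
Qed.

(** A larger [L] excludes more triples and tightens the caps; this is the [score_upd] hypothesis of
    [greedy_picks]. *)
Lemma linkS L L' x : L \subset L' -> link L' x \subset link L x.
Proof.
move=> LL'; apply/fintype.subsetP => t; rewrite inE.
move=> /andP[tA /and4P[tx tL c2 c3]]; rewrite inE tA tx /=; apply/and3P; split.
- by apply: contraNN tL; apply: fintype.subsetP.
- by apply: leq_trans c2; rewrite leq_mul2r deg2S ?orbT.
- by apply: leq_trans c3; rewrite leq_mul2r deg3S ?orbT.
Qed.

Lemma card_link_upd L x : #|L| + #|link L x| = #|L :|: link L x|.
Proof.
rewrite cardsU (_ : L :&: link L x = finset.set0) ?cards0 ?subn0 //.
by apply/setP => t; rewrite !inE; case: (t \in L); rewrite ?andbF.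
Qed.

Lemma links_sub us : links us \subset triples A.
Proof.
elim: us => [|u us IH]; first by rewrite links_nil finset.sub0set.
rewrite links_cons finset.subUset IH; apply/fintype.subsetP => t.
by rewrite 1!inE => /andP[].
Qed.

Lemma links_fst us t : t \in links us -> t.1.1 \in us.
Proof.
elim: us => [|u us IH]; first by rewrite links_nil inE.
rewrite links_cons inE => /orP[/IH|]; first by rewrite inE => ->; rewrite orbT.
by rewrite inE => /and3P[_ /eqP-> _]; rewrite mem_head.
Qed.

Lemma triplesE A' t : t \in triples A' -> E t.1.1 t.1.2 t.2.
Proof. by rewrite inE => /and4P[]. Qed.

(* Picking [u] adds at most one triple above each y and each z. *)
Lemma deg2_links us y :
  deg2 (links us) y * v <= s * deg2 (triples A) y + v.
Proof.
elim: us => [|u us IH].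
  by rewrite links_nil deg2_set0.
rewrite links_cons; set L := links us in IH *.
case: (set_0Vmem [set t in link L u | t.1.2 == y]) => [L0|[t]].
  rewrite (_ : deg2 _ y = deg2 L y) //; apply: eq_card => t.
  move/setP/(_ t): L0; rewrite finset.in_set0 inE => L0.
  by rewrite inE [in RHS]inE finset.in_setU andb_orl L0 orbF.
rewrite 2!inE => /andP[/and3P[tA /eqP tu /and3P[_ c2 _]] /eqP ty].
rewrite ty in c2; apply: leq_trans (leq_add c2 (leqnn v)).
rewrite -mulSnr leq_mul2r; apply/orP; right.
rewrite -addn1 -(cards1 t); apply: leq_trans (leq_card_setU _ _).
apply: subset_leq_card; apply/fintype.subsetP => t'.
rewrite 2!inE => /andP[/orP[t'L|t'l] /eqP t'y].
  by rewrite !inE t'L t'y eqxx.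
move: t'l; rewrite inE => /and3P[t'A /eqP t'u _]; rewrite finset.in_setU finset.in_set1.
apply/orP; right; case: t t' tA tu ty t'A t'u t'y {c2} => [[x1 y1] z1] [[x2 y2] z2] /=.
move=> /triplesE /= E1 ? ? /triplesE /= E2 ? ?; subst.
by rewrite (E_inj3 E1 E2).
Qed.

Lemma deg3_links us z :
  deg3 (links us) z * v <= s * deg3 (triples A) z + v.
Proof.
elim: us => [|u us IH].
  by rewrite links_nil deg3_set0.
rewrite links_cons; set L := links us in IH *.
case: (set_0Vmem [set t in link L u | t.2 == z]) => [L0|[t]].
  rewrite (_ : deg3 _ z = deg3 L z) //; apply: eq_card => t.
  move/setP/(_ t): L0; rewrite finset.in_set0 inE => L0.
  by rewrite inE [in RHS]inE finset.in_setU andb_orl L0 orbF.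
rewrite 2!inE => /andP[/and3P[tA /eqP tu /and3P[_ _ c3]] /eqP tz].
rewrite tz in c3; apply: leq_trans (leq_add c3 (leqnn v)).
rewrite -mulSnr leq_mul2r; apply/orP; right.
rewrite -addn1 -(cards1 t); apply: leq_trans (leq_card_setU _ _).
apply: subset_leq_card; apply/fintype.subsetP => t'.
rewrite 2!inE => /andP[/orP[t'L|t'l] /eqP t'z].
  by rewrite !inE t'L t'z eqxx.
move: t'l; rewrite inE => /and3P[t'A /eqP t'u _]; rewrite finset.in_setU finset.in_set1.
apply/orP; right; case: t t' tA tu tz t'A t'u t'z {c3} => [[x1 y1] z1] [[x2 y2] z2] /=.
move=> /triplesE /= E1 ? ? /triplesE /= E2 ? ?; subst.
by rewrite (E_inj2 E1 E2).
Qed.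

Section Phase2.
Variable us : seq V.
Let L := links us.

Definition nbh y : {set V} := [set t.2 | t in [set t in L | t.1.2 == y]].
(** Each new last entry is weighted by its degree in [L], so that the second greedy phase maximises
    the triples of [L] lost with the hit points rather than the number of these points. *)
Definition score2 (Z : {set V}) y :=
  \sum_(t in L | (t.1.2 == y) && (t.2 \notin Z)) deg3 L t.2.
Definition hit := greedy_state (fun Z y => Z :|: nbh y) finset.set0.
Definition mass3 (Z : {set V}) := \sum_(z in Z) deg3 L z.

Lemma score2_upd Z u x : score2 (Z :|: nbh u) x <= score2 Z x.
Proof.
rewrite /score2 [leqRHS](bigID (fun t => t.2 \in nbh u)) /=.
apply: leq_trans (leq_addl _ _); apply: eq_leq; apply: eq_bigl => t.
by rewrite !inE negb_or !andbA.
Qed.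

(** Middle and last entries determine the first, so distinct triples of [L] above [u] end in
    distinct points and no weight is counted twice. *)
Lemma mass3_upd Z u : mass3 Z + score2 Z u <= mass3 (Z :|: nbh u).
Proof.
rewrite /mass3 [leqRHS](bigID (mem Z)) /=; apply: leq_add.
  by apply: eq_leq; apply: eq_bigl => z; rewrite inE; case: (z \in Z); rewrite ?andbF.
rewrite (eq_bigl (fun z => z \in [set t.2 | t in
    [set t in L | (t.1.2 == u) && (t.2 \notin Z)]])).
  rewrite big_imset /=; first by apply: eq_leq; apply: eq_bigl => t; rewrite inE.
  move=> [[x1 y1] z1] [[x2 y2] z2]; rewrite !inE /=.
  move=> /and3P[t1 /eqP y1u _] /and3P[t2 /eqP y2u _] zz; subst.
  have /= E1 := triplesE (fintype.subsetP (links_sub _) _ t1).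
  have /= E2 := triplesE (fintype.subsetP (links_sub _) _ t2).
  by rewrite (E_inj1 E1 E2).
move=> z; rewrite !inE; apply/andP/imsetP => [[/orP[zZ|/imsetP[t]]]|[t]].
- by rewrite zZ.
- by rewrite inE => /andP[tL ty] -> tZ; exists t => //; rewrite inE tL ty.
- rewrite inE => /and3P[tL ty tZ] ->; rewrite (negbTE tZ); split => //=.
  by apply/imsetP; exists t; rewrite // inE tL.
Qed.

Lemma hitP ys z : z \in hit ys ->
  exists t, [/\ t \in L, t.1.2 \in ys & t.2 = z].
Proof.
elim: ys => [|y ys IH] /=; first by rewrite inE.
rewrite inE => /orP[/IH[t [tL ty tz]]|/imsetP[t]].
  by exists t; rewrite in_cons ty orbT.
by rewrite inE => /andP[tL /eqP ty] ->; exists t; rewrite in_cons ty eqxx.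
Qed.

Lemma hit_sub ys : hit ys \subset A.
Proof.
apply/fintype.subsetP => z /hitP[t [tL _ <-]].
by have := fintype.subsetP (links_sub us) t tL; rewrite inE => /and4P[].
Qed.

Definition high1 x0 : {set V} := [set x in A | #|link L x0| < #|link L x|].
Definition high2 Z y0 : {set V} := [set y in A | score2 Z y0 < score2 Z y].

Lemma sum_deg2_le D X : \sum_(y in D) deg2 X y <= #|X|.
Proof.
rewrite -(card_fibers X (fun t => t.1.2)); apply: subset_leq_card.
by apply/fintype.subsetP => t; rewrite inE => /andP[].
Qed.

Lemma sum_deg3_le D X : \sum_(z in D) deg3 X z <= #|X|.
Proof.
rewrite -(card_fibers X (fun t => t.2)); apply: subset_leq_card.
by apply/fintype.subsetP => t; rewrite inE => /andP[].
Qed.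

(** A triple of [A] starts in [high1 x0], or lies in the link of its first entry, or is already in
    [L], or has a middle or last entry over its cap. Each of the last four kinds numbers at most
    [v * #|L| / s]: outside [high1] a link is no larger than that of [x0], [s <= v], and an exceeded
    cap charges triples of [A] to triples of [L]. *)
Lemma phase1_bound x0 : s <= v -> s * #|link L x0| <= #|L| ->
  s * e <= s * #|[set t in triples A | t.1.1 \in high1 x0]| + 4 * v * #|L|.
Proof.
move=> sv Hx0.
pose S2 := [set t in triples A |
  t.1.2 \in [set y | s * deg2 (triples A) y < deg2 L y * v]].
pose S3 := [set t in triples A |
  t.2 \in [set z | s * deg3 (triples A) z < deg3 L z * v]].
pose T1 := [set t in triples A | t.1.1 \in high1 x0].
pose T2 := [set t in [set t | t \in link L t.1.1] | t.1.1 \in A :\: high1 x0].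
have cover : e <= #|T1| + #|T2| + #|L| + #|S2| + #|S3|.
  apply: leq_trans (subset_leq_card _) _; last first.
    apply: leq_trans (leq_card_setU (T1 :|: T2 :|: L :|: S2) S3) _.
    rewrite leq_add2r; apply: leq_trans (leq_card_setU (T1 :|: T2 :|: L) S2) _.
    rewrite leq_add2r; apply: leq_trans (leq_card_setU (T1 :|: T2) L) _.
    rewrite leq_add2r; exact: leq_card_setU.
  apply/fintype.subsetP => t tA.
  have xA : t.1.1 \in A by move: tA; rewrite inE => /and4P[].
  rewrite !finset.in_setU.
  have [|x1] := boolP (t \in T1); first by [].
  have [|x2] := boolP (t \in L); first by rewrite !orbT.
  have [|x3] := boolP (t \in S2); first by rewrite !orbT.
  have [|x4] := boolP (t \in S3); first by rewrite !orbT.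
  rewrite /= !orbF; move: x1 x3 x4; rewrite inE tA /= => x1.
  rewrite inE tA /= inE -leqNgt => x3; rewrite inE tA /= inE -leqNgt => x4.
  by rewrite inE finset.in_setD xA x1 !andbT inE inE tA eqxx x2 x3.
have HT2 : s * #|T2| <= v * #|L|.
  apply: (@leq_trans (s * (v * #|link L x0|))); last first.
    by rewrite mulnCA leq_mul2l Hx0 orbT.
  rewrite leq_mul2l; apply/orP; right.
  rewrite /T2 (card_fibers _ (fun t => t.1.1)).
  apply: (@leq_trans (\sum_(x in A :\: high1 x0) #|link L x0|)); last first.
    by rewrite sum_nat_const leq_mul2r subset_leq_card ?orbT // subsetDl.
  apply: leq_sum => x; rewrite finset.in_setD => /andP[+ xA].
  rewrite inE xA /= -leqNgt; apply: leq_trans.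
  apply: subset_leq_card; apply/fintype.subsetP => t.
  by rewrite 2!inE => /andP[+ /eqP <-].
have HS2 : s * #|S2| <= v * #|L|.
  rewrite /S2 (card_fibers _ (fun t => t.1.2)) big_distrr /=.
  apply: leq_trans (leq_mul (leqnn v) (sum_deg2_le _ L)).
  rewrite big_distrr /=; apply: leq_sum => y; rewrite inE mulnC => /ltnW.
  by rewrite mulnC [v * _]mulnC.
have HS3 : s * #|S3| <= v * #|L|.
  rewrite /S3 (card_fibers _ (fun t => t.2)) big_distrr /=.
  apply: leq_trans (leq_mul (leqnn v) (sum_deg3_le _ L)).
  rewrite big_distrr /=; apply: leq_sum => y; rewrite inE mulnC => /ltnW.
  by rewrite mulnC [v * _]mulnC.
have HL : s * #|L| <= v * #|L| by rewrite leq_mul2r sv orbT.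
apply: leq_trans (leq_mul (leqnn s) cover) _.
rewrite !mulnDr -!addnA leq_add2l -mulnA; lia.
Qed.

(** [l'] counts the triples of [L] avoiding both [high2] and the hit points. By Cauchy-Schwarz over
    last entries, its square is at most [v] times the total score outside [high2], where each score
    is at most that of [y0]. *)
Lemma phase2_bound ys y0 : s * score2 (hit ys) y0 <= mass3 (hit ys) ->
  exists l', [/\ #|L| <= l' + \sum_(y in high2 (hit ys) y0) deg2 L y + mass3 (hit ys) &
    s * l' ^ 2 <= v ^ 2 * mass3 (hit ys)].
Proof.
set Z := hit ys => Hy0; set D := high2 Z y0.
pose L' := [set t in L | (t.1.2 \notin D) && (t.2 \notin Z)].
exists #|L'|; split.
  rewrite -(card_fibers L (fun t => t.1.2)) /mass3 -(card_fibers L (fun t => t.2)).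
  apply: leq_trans (subset_leq_card _) _; last first.
    apply: leq_trans (leq_card_setU (L' :|: [set t in L | t.1.2 \in D])
      [set t in L | t.2 \in Z]) _.
    by rewrite leq_add2r; exact: leq_card_setU.
  apply/fintype.subsetP => t tL; rewrite !finset.in_setU.
  have [tZ|tZ] := boolP (t.2 \in Z); first by apply/orP; right; rewrite inE tL.
  apply/orP; left; have [tD|tD] := boolP (t.1.2 \in D); apply/orP.
    by right; rewrite inE tL.
  by left; rewrite inE tL tD tZ.
have H1 : #|L'| ^ 2 <= v * \sum_(y in A :\: D) score2 Z y.
  have memA t : t \in L -> t.1.2 \in A /\ t.2 \in A.
    by move/(fintype.subsetP (links_sub _)); rewrite inE => /and4P[].
  have -> : #|L'| = \sum_(z in A) deg3 L' z.
    rewrite -(card_fibers L' (fun t => t.2)); apply: eq_card => t.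
    rewrite [in RHS]inE; case: (boolP (t \in L')) => //=; rewrite inE.
    by case/andP => /memA[_ ->].
  apply: leq_trans (leq_sqr_sum _ _) _; rewrite leq_mul2l; apply/orP; right.
  apply: (@leq_trans (\sum_(t in L' | t.2 \in A) deg3 L' t.2)).
    by rewrite (sum_fibers L' (fun t => t.2)); apply: eq_leq; apply: eq_bigr.
  rewrite /score2 (exchange_big_dep (mem L)) /=; last by move=> y t _ /andP[].
  rewrite [leqRHS](bigID (mem L')) /=.
  apply: leq_trans (leq_addr _ _).
  rewrite [leqRHS](eq_bigl (mem L')); last first.
    by move=> t /=; rewrite [t \in L']inE; case: (t \in L).
  rewrite [leqLHS](eq_bigl (mem L')); last first.
    move=> t /=; case: (boolP (t \in L')) => //=; rewrite inE.
    by case/andP => /memA[_ ->].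
  apply: leq_sum => t tL'; move: (tL' : t \in L').
  rewrite inE => /and3P[tL tD tZ].
  have [yA zA] := memA t tL.
  rewrite (bigD1 t.1.2) /=; last by rewrite finset.in_setD tD yA tL eqxx tZ.
  apply: leq_trans (leq_addr _ _); apply: deg3S.
  by apply/fintype.subsetP => t'; rewrite inE => /andP[].
have H2 : \sum_(y in A :\: D) score2 Z y <= v * score2 Z y0.
  apply: (@leq_trans (\sum_(x in A :\: D) score2 Z y0)); last first.
    by rewrite sum_nat_const leq_mul2r subset_leq_card ?orbT // subsetDl.
  apply: leq_sum => y; rewrite finset.in_setD => /andP[+ yA].
  by rewrite inE yA /= -leqNgt.
apply: leq_trans (leq_mul (leqnn s) H1) _.
apply: leq_trans (leq_mul (leqnn s) (leq_mul (leqnn v) H2)) _.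
by rewrite [v * (v * _)]mulnA mulnn mulnCA leq_mul2l Hy0 orbT.
Qed.

End Phase2.

(** Suppose all three counts are below [e'/20] and put [X = s' e']. Then [4 v' l >= 19X/20], while
    [v' d2] and [v' r] are at most [X/20 + X/80], which leaves [80 v' l' >= 9X]. Squaring gives
    [81 s' X <= 400 v'^3], against [10 v'^3 < s' X]. *)
Lemma one_step_numeric e' v' s' l l' d2 r w1 w2 w3 :
  s' * e' <= s' * w1 + 4 * v' * l -> l <= l' + d2 + r ->
  s' * l' ^ 2 <= v' ^ 2 * r ->
  d2 * v' <= s' * w2 + v' ^ 2 -> r * v' <= s' * w3 + v' ^ 2 ->
  10 * v' ^ 3 < s' ^ 2 * e' -> 80 * v' ^ 2 <= s' * e' ->
  [|| e' <= 20 * w1, e' <= 20 * w2 | e' <= 20 * w3].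
Proof.
move=> H1 H2 H3 H4 H5 H6 H7; apply/negPn/negP; rewrite !negb_or -!ltnNge.
case/and3P => W1 W2 W3.
have X1 : s' * (20 * w1) <= s' * e' by rewrite leq_mul2l ltnW ?orbT.
have X2 : s' * (20 * w2) <= s' * e' by rewrite leq_mul2l ltnW ?orbT.
have X3 : s' * (20 * w3) <= s' * e' by rewrite leq_mul2l ltnW ?orbT.
have Y1 : v' * l <= v' * l' + v' * d2 + v' * r by rewrite -!mulnDr leq_mul2l H2 orbT.
set X := s' * e' in H1 H7 X1 X2 X3.
have Z : 9 * X <= 80 * (v' * l') by lia.
have Z5 : 80 * (r * v') <= 5 * X by lia.
have Z2 : (9 * X) ^ 2 <= (80 * (v' * l')) ^ 2 by rewrite leq_sqr.
have Z4 : s' * (9 * X) ^ 2 <= 80 * v' ^ 3 * (80 * (r * v')).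
  apply: (@leq_trans (s' * (80 * (v' * l')) ^ 2)).
    by rewrite leq_mul2l Z2 orbT.
  have -> : s' * (80 * (v' * l')) ^ 2 = 80 * (80 * (v' ^ 2 * (s' * l' ^ 2))).
    by rewrite !expnMn -[80 ^ 2]mulnn; move: (v' ^ 2) (l' ^ 2) => a b; ring.
  have -> : 80 * v' ^ 3 * (80 * (r * v')) = 80 * (80 * (v' ^ 2 * (v' ^ 2 * r))).
    by rewrite !expnS expn0; ring.
  by rewrite !leq_mul2l H3 !orbT.
have Z6 : s' * (9 * X) ^ 2 <= 80 * v' ^ 3 * (5 * X).
  by apply: leq_trans Z4 _; rewrite leq_mul2l Z5 orbT.
have Z8 : s' ^ 2 * e' = s' * X by rewrite /X -mulnn mulnA.
have X0 : 0 < X.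
  rewrite lt0n; apply/eqP => X0; by rewrite Z8 X0 muln0 ltn0 in H6.
have Z7 : X * (81 * (s' * X)) <= X * (400 * v' ^ 3).
  have -> : X * (81 * (s' * X)) = s' * (9 * X) ^ 2 by rewrite expnMn -!mulnn; ring.
  by have -> : X * (400 * v' ^ 3) = 80 * v' ^ 3 * (5 * X) by ring.
rewrite leq_pmul2l // in Z7.
by move: Z7 H6; rewrite Z8; move: (s' * X) (v' ^ 3) => a b; clear; lia.
Qed.

Lemma sum_deg2_links us D : D \subset A ->
  (\sum_(y in D) deg2 (links us) y) * v <=
  s * #|[set t in triples A | t.1.2 \in D]| + v ^ 2.
Proof.
move=> DA; rewrite (card_fibers _ (fun t => t.1.2)) big_distrl big_distrr /=.
apply: (@leq_trans (\sum_(y in D) (s * deg2 (triples A) y + v))).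
  by apply: leq_sum => y _; apply: deg2_links.
by rewrite big_split /= leq_add2l sum_nat_const -mulnn leq_mul2r subset_leq_card ?orbT.
Qed.

Lemma sum_deg3_links us D : D \subset A ->
  (\sum_(z in D) deg3 (links us) z) * v <=
  s * #|[set t in triples A | t.2 \in D]| + v ^ 2.
Proof.
move=> DA; rewrite (card_fibers _ (fun t => t.2)) big_distrl big_distrr /=.
apply: (@leq_trans (\sum_(y in D) (s * deg3 (triples A) y + v))).
  by apply: leq_sum => y _; apply: deg3_links.
by rewrite big_split /= leq_add2l sum_nat_const -mulnn leq_mul2r subset_leq_card ?orbT.
Qed.

(** The fingerprint [p] holds the picks of both phases and the two best points [x0], [y0] of [I];
    the candidates depend on [I] through nothing else. *)
Definition one_step_sets (p : s.-tuple V * V * (s.-tuple V * V)) : seq {set V} :=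
  let: (us, x0, (ys, y0)) := p in
  [:: A :\: high1 us x0; A :\: high2 us (hit us ys) y0; A :\: hit us ys].

(** [high1] and [high2] miss [I] by maximality of [x0] and [y0] on [I]; [hit] misses it because a
    hit point completes a triple whose other two entries are picks from [I]. *)
Lemma one_step_cover I :
  s <= v -> 10 * v ^ 3 < s ^ 2 * e -> 80 * v ^ 2 <= s * e ->
  I \subset A -> indep I -> I != finset.set0 ->
  exists p, exists2 C, C \in one_step_sets p &
    (I \subset C) && (20 * #|triples C| <= 19 * e).
Proof.
move=> sv H1 H2 IA indI /set0Pn[i0 i0I].
have ILfst us t : all (mem I) us -> t \in links us -> t.1.1 \in I.
  by move=> /allP usI /links_fst /usI.
have [us [szus usI Hus]] := greedy_picks
  (fun L u => eq_leq (card_link_upd L u))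
  (fun L u x => subset_leq_card (linkS x (finset.subsetUl L (link L u))))
  finset.set0 s i0I.
have [ys [szys ysI Hys]] := greedy_picks (@mass3_upd us) (@score2_upd us)
  finset.set0 s i0I.
rewrite -/(links us) in Hus; rewrite -/(hit us ys) in Hys.
case: (arg_maxnP (fun x => #|link (links us) x|) i0I) => x0 x0I x0max.
case: (arg_maxnP (fun y => score2 us (hit us ys) y) i0I) => y0 y0I y0max.
have Hsize1 : size us == s by rewrite szus.
have Hsize2 : size ys == s by rewrite szys.
exists (Tuple Hsize1, x0, (Tuple Hsize2, y0)).
have [l' [Hl1 Hl2]] := phase2_bound (Hys _ y0I).
have B1A : high1 us x0 \subset A by apply/fintype.subsetP => x; rewrite inE => /andP[].
have B2A : high2 us (hit us ys) y0 \subset A.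
  by apply/fintype.subsetP => x; rewrite inE => /andP[].
have sub D : [disjoint I & D] -> I \subset A :\: D by rewrite finset.subsetD IA.
have := one_step_numeric (phase1_bound sv (Hus _ x0I)) Hl1 Hl2
  (sum_deg2_links us B2A) (sum_deg3_links us (hit_sub us ys)) H1 H2.
have fin D (f : V * V * V -> V) : e <= 20 * #|[set t in triples A | f t \in D]| ->
    (forall t, t \in triples A -> f t \in D -> t \notin triples (A :\: D)) ->
    20 * #|triples (A :\: D)| <= 19 * e.
  by move=> He /card_triples_setD; rewrite -/e; clear -He; lia.
case/or3P => He.
- exists (A :\: high1 us x0); first by rewrite mem_head.
  rewrite sub /=.
    by apply: (fin _ _ He) => t _ tD; rewrite inE finset.in_setD tD.
  rewrite finset.disjoints_subset; apply/fintype.subsetP => x xI; rewrite inE.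
  by rewrite inE negb_and -leqNgt; apply/orP; right; apply: x0max.
- exists (A :\: high2 us (hit us ys) y0); first by rewrite !in_cons eqxx orbT.
  rewrite sub /=.
    by apply: (fin _ _ He) => t _ tD; rewrite inE !finset.in_setD tD andbF.
  rewrite finset.disjoints_subset; apply/fintype.subsetP => x xI; rewrite inE.
  by rewrite inE negb_and -leqNgt; apply/orP; right; apply: y0max.
- exists (A :\: hit us ys); first by rewrite !in_cons eqxx !orbT.
  rewrite sub /=.
    by apply: (fin _ _ He) => t _ tD; rewrite inE !finset.in_setD tD !andbF.
  rewrite finset.disjoints_subset; apply/fintype.subsetP => z zI; rewrite inE.
  apply/negP => /hitP[t [tL ty tz]].
  have := indI _ _ _ (ILfst _ _ usI tL) (allP ysI _ ty) zI.
  by rewrite -tz (triplesE (fintype.subsetP (links_sub us) _ tL)).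
Qed.

End OneStep.

(** * Families of containers and their iteration *)

Definition container_family A (P : {set V} -> Prop) (F : {set {set V}}) :=
  (forall C, C \in F -> P C) /\
  (forall I, I \subset A -> indep I -> exists2 C, C \in F & I \subset C).

Lemma one_step_family A s : 1 < #|V| ->
  10 * #|A| ^ 3 < s ^ 2 * #|triples A| -> 80 * #|A| ^ 2 <= s * #|triples A| ->
  exists2 F : {set {set V}}, #|F| <= #|V| ^ (2 * s + 4) &
    container_family A (fun C => 20 * #|triples C| <= 19 * #|triples A|) F.
Proof.
move=> V1 H1 H2; have V0 := ltnW V1.
(* For [s > #|A|] all triple-free subsets of [A] serve as containers; there are at most [2 ^ s]. *)
have [sA|As] := leqP s #|A|; last first.
  exists [set I in powerset A | triples I == finset.set0].
    apply: (@leq_trans (2 ^ s)).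
      apply: leq_trans (_ : 2 ^ #|A| <= _); last by rewrite leq_exp2l ?(ltnW As).
      rewrite -card_powerset; apply: subset_leq_card.
      by apply/fintype.subsetP => C; rewrite inE => /andP[].
    apply: (@leq_trans (#|V| ^ s)); first by case: (s) => // s'; rewrite leq_exp2r.
    by rewrite leq_pexp2l //; lia.
  split=> [C|I IA indI].
    by rewrite inE => /andP[_ /eqP->]; rewrite cards0 muln0.
  by exists I; rewrite // inE powersetE IA triples_indep ?eqxx.
(* The empty set is added for [I] empty, which has no best point. *)
pose F := finset.set0 |: [set C |
  [exists p : s.-tuple V * V * (s.-tuple V * V), C \in one_step_sets A p] &&
  (20 * #|triples C| <= 19 * #|triples A|)].
exists F; last first.
  split=> [C|I IA indI].
    rewrite 3!inE => /orP[/eqP->|/andP[]//].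
    by rewrite triples_indep ?cards0 ?muln0 // => x y z; rewrite inE.
  have [->|I0] := eqVneq I finset.set0.
    by exists finset.set0; rewrite ?finset.sub0set // !inE eqxx.
  have [p [C Cp /andP[IC HC]]] := one_step_cover sA H1 H2 IA indI I0.
  exists C => //; rewrite 3!inE HC andbT; apply/orP; right.
  by apply/existsP; exists p.
pose i3 (p : (s.-tuple V * V * (s.-tuple V * V)) * 'I_3) :=
  nth finset.set0 (one_step_sets A p.1) p.2.
(* Two [s]-tuples, two points and three candidates, plus the empty set; the factor 4 is absorbed by
   [#|V| ^ 2]. *)
apply: (@leq_trans (1 + 3 * #|V| ^ (2 * s + 2))); last first.
  have -> : 2 * s + 4 = 2 + (2 * s + 2) by lia.
  rewrite (expnD _ 2); have : 0 < #|V| ^ (2 * s + 2) by rewrite expn_gt0 V0.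
  move: (#|V| ^ (2 * s + 2)) => G G0; have : 4 * G <= #|V| ^ 2 * G.
    by rewrite leq_mul2r (leq_sqr 2) V1 orbT.
  by apply: leq_trans; clear -G0; lia.
apply: leq_trans (leq_card_setU _ _) _; rewrite cards1 leq_add2l.
apply: leq_trans (subset_leq_card (_ : _ \subset [set i3 p | p in predT])) _.
  apply/fintype.subsetP => C; rewrite inE => /andP[/existsP[p Cp] _].
  have ip : index C (one_step_sets A p) < 3.
    by move: Cp; rewrite -index_mem; case: p => [[? ?] [? ?]].
  apply/imsetP; exists (p, Ordinal ip) => //.
  by rewrite /i3 /= nth_index.
apply: leq_trans (leq_imset_card _ _) _.
rewrite !card_prod !card_tuple card_ord; apply: eq_leq.
have -> : 2 * s + 2 = s + s + 1 + 1 by lia.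
by rewrite !expnD expn1; lia.
Qed.

(** Sets spanning at most [theta] triples are left alone; the others are refined by
    [one_step_family], and the sizes of the nested families multiply. *)
Lemma iterated_family (R : realType) (theta : R) (s : nat) : 1 < #|V| ->
  (forall A, (theta < #|triples A|%:R)%R ->
     10 * #|A| ^ 3 < s ^ 2 * #|triples A| /\
     80 * #|A| ^ 2 <= s * #|triples A|) ->
  forall k A, (#|triples A|%:R * (19 / 20) ^+ k <= theta)%R ->
  exists2 F : {set {set V}}, #|F| <= #|V| ^ ((2 * s + 4) * k) &
    container_family A (fun C => #|triples C|%:R <= theta)%R F.
Proof.
move=> V1 Hs; have V0 := ltnW V1.
have triv A k : (#|triples A|%:R <= theta)%R ->
    exists2 F : {set {set V}}, #|F| <= #|V| ^ ((2 * s + 4) * k) &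
      container_family A (fun C => #|triples C|%:R <= theta)%R F.
  move=> HA; exists (finset.set1 A).
    by rewrite cards1 expn_gt0 V0.
  split=> [C|I IA _]; first by rewrite inE => /eqP->.
  by exists A; rewrite // inE.
elim=> [|k IH] A; first by rewrite expr0 mulr1 => HA; apply: triv.
have [HA _|HA Hk] := leP (#|triples A|%:R)%R theta; first exact: triv.
have [H1 H2] := Hs A HA.
have [F1 HF1 [PF1 CF1]] := one_step_family V1 H1 H2.
have step (C : {set V}) : C \in F1 -> exists F : {set {set V}},
    #|F| <= #|V| ^ ((2 * s + 4) * k) /\
    container_family C (fun C => #|triples C|%:R <= theta)%R F.
  move=> /PF1 HC; have [|F ? ?] := IH C; last by exists F.
  apply: le_trans Hk; rewrite exprS mulrA ler_wpM2r ?exprn_ge0 ?divr_ge0 //.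
  have : ((20 * #|triples C|)%:R <= (19 * #|triples A|)%:R :> R)%R.
    by rewrite ler_nat.
  by rewrite !natrM; lra.
have /boolp.choice[G HG] : forall C, exists F : {set {set V}}, C \in F1 ->
    #|F| <= #|V| ^ ((2 * s + 4) * k) /\
    container_family C (fun C => #|triples C|%:R <= theta)%R F.
  move=> C; case: (boolP (C \in F1)) => [/step[F HF]|_]; first by exists F.
  by exists finset.set0.
exists (\bigcup_(C in F1) G C)%SET.
  apply: (@leq_trans (\sum_(C in F1) #|G C|)).
    elim/big_rec2: _ => [|C n X _ HX]; first by rewrite cards0.
    by apply: leq_trans (leq_card_setU _ _) _; rewrite leq_add2l.
  apply: (@leq_trans (\sum_(C in F1) #|V| ^ ((2 * s + 4) * k))).
    by apply: leq_sum => C /HG[].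
  by rewrite sum_nat_const mulnS expnD leq_mul2r HF1 orbT.
split=> [C /finset.bigcupP[C1 /HG[_ [+ _]]]|I IA indI]; first exact.
have [C1 C1F IC1] := CF1 I IA indI.
have [_ [_ /(_ I IC1 indI)[C CG IC]]] := HG C1 C1F.
by exists C => //; apply/finset.bigcupP; exists C1.
Qed.

End Containers.

Local Open Scope ring_scope.

(** * The Ellenberg-Gijswijt bound *)

Section SliceRank.
Variable F : fieldType.

(** Some [r] columns form an invertible minor, so the row space reaches the all-ones vector on them.
    Applied to a basis of a kernel, this gives an annihilating vector with large support. *)
Lemma row_free_ones (r k : nat) (A : 'M[F]_(r, k)) : row_free A ->
  exists (h : 'rV[F]_r) (f : 'I_r -> 'I_k),
    injective f /\ forall i, (h *m A) 0 (f i) = 1.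
Proof.
move=> freeA.
have fullAT : row_full A^T by rewrite /row_full mxrank_tr; exact: freeA.
pose f := fullrankfun fullAT; pose B := (rowsub f A^T)^T.
have unitB : B \in unitmx by rewrite unitmx_tr fullrowsub_unit.
pose h : 'rV[F]_r := const_mx 1 *m invmx B.
exists h, f; split; first exact: fullrankfun_inj.
move=> i; transitivity ((h *m B) 0 i).
  by rewrite mxE [RHS]mxE; apply: eq_bigr => j _; rewrite [B _ _]mxE !mxE.
by rewrite /h -mulmxA mulVmx // mulmx1 mxE.
Qed.

(* Contracting the first variable against a vector in the kernel of X kills the
   slices in x and leaves a diagonal matrix with many ones. *)
Lemma slice_rank_diagonal (k M : nat) (X : 'M[F]_(k, M))
    (G1 G2 G3 : 'I_M -> 'I_k -> 'I_k -> F) :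
  (forall x y z : 'I_k, ((x == y) && (y == z))%:R =
     \sum_g X x g * G1 g y z + \sum_g X y g * G2 g x z
     + \sum_g X z g * G3 g x y) ->
  (k <= 3 * M)%N.
Proof.
move=> HT; have [c [f [f_inj Hf]]] := row_free_ones (row_base_free (kermx X)).
set h := c *m row_base (kermx X) in Hf.
have hX : h *m X = 0.
  by apply/sub_kermxP; apply: submx_trans (submxMl _ _) _; rewrite eq_row_base.
pose B := \matrix_(g < M, z < k) \sum_x h 0 x * G2 g x z.
pose C := \matrix_(y < k, g < M) \sum_x h 0 x * G3 g x y.
have HQ y z : h 0 y * (y == z)%:R = (X *m B + C *m X^T) y z.
  transitivity (\sum_x h 0 x * ((x == y) && (y == z))%:R).
    rewrite (bigD1 y) //= eqxx big1 ?addr0 // => x xy.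
    by rewrite (negbTE xy) mulr0.
  under eq_bigr do rewrite HT !mulrDr.
  rewrite !big_split /=.
  have -> : \sum_x h 0 x * (\sum_g X x g * G1 g y z) = 0.
    under eq_bigr do rewrite big_distrr /=.
    rewrite exchange_big /= big1 // => g _.
    under eq_bigr do rewrite mulrA.
    rewrite -big_distrl /=.
    by move/matrixP/(_ 0 g): hX; rewrite !mxE => ->; rewrite mul0r.
  rewrite add0r [RHS]mxE; congr (_ + _); rewrite mxE.
    under eq_bigr do rewrite big_distrr /=.
    rewrite exchange_big /=; apply: eq_bigr => g _.
    by rewrite mxE big_distrr /=; apply: eq_bigr => x _; rewrite mulrCA.
  under eq_bigr do rewrite big_distrr /=.
  rewrite exchange_big /=; apply: eq_bigr => g _.
  by rewrite !mxE big_distrl /=; apply: eq_bigr => x _; rewrite mulrA mulrAC.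
(* Where [h] is 1 the contracted tensor is an identity matrix of size [\rank (kermx X) >= k - M],
   and two products through dimension [M] have rank at most [2M]. *)
have sub1 : mxsub f f (X *m B + C *m X^T) = 1%:M.
  apply/matrixP => i j; rewrite mxE -HQ [RHS]mxE Hf mul1r.
  by rewrite (inj_eq f_inj).
have rk : (\rank (kermx X) <= 2 * M)%N.
  rewrite -[X in (X <= _)%N](mxrank1 F) -sub1 raddfD /=.
  apply: leq_trans (mxrank_add _ _) _; rewrite mul2n -addnn; apply: leq_add.
    by rewrite mxsub_mul; apply: mulmx_max_rank.
  by rewrite mxsub_mul; apply: mulmx_max_rank.
move: rk; rewrite mxrank_ker => rk; have := rank_leq_col X; lia.
Qed.

Lemma slice_rank_diagonal_set (T J : finType) (A : {set T}) (S : {set J})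
    (X : T -> J -> F) (G1 G2 G3 : J -> T -> T -> F) :
  (forall x y z, x \in A -> y \in A -> z \in A -> ((x == y) && (y == z))%:R =
     \sum_(g in S) X x g * G1 g y z + \sum_(g in S) X y g * G2 g x z
     + \sum_(g in S) X z g * G3 g x y) ->
  (#|A| <= 3 * #|S|)%N.
Proof.
move=> HT; pose v (i : 'I_#|A|) : T := enum_val i.
pose w (g : 'I_#|S|) : J := enum_val g.
apply: (@slice_rank_diagonal _ _ (\matrix_(i, g) X (v i) (w g))
  (fun g i j => G1 (w g) (v i) (v j)) (fun g i j => G2 (w g) (v i) (v j))
  (fun g i j => G3 (w g) (v i) (v j))) => x y z.
have := HT (v x) (v y) (v z) (enum_valP _) (enum_valP _) (enum_valP _).
rewrite /v 2!(inj_eq enum_val_inj) => ->.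
by congr (_ + _ + _); rewrite big_enum_val; apply: eq_bigr => g _; rewrite mxE.
Qed.

End SliceRank.

Section EllenbergGijswijt.
Variable F : finFieldType.
Let q := #|F|.

Lemma finField_expf_pred (a : F) : a ^+ q.-1 = (a != 0)%:R.
Proof.
have q1 : (1 < q)%N by exact: finRing_gt1.
have [->|a0] := eqVneq a 0; first by rewrite expr0n; case: q q1 => [|[]].
apply: (mulfI a0); rewrite -exprS prednK ?(ltnW q1) // mulr1.
exact: expf_card.
Qed.

(** Only the degrees of the monomials matter later, so index type and coefficients stay existential.
    In the induction [None], [Some true] and [Some false] pick [u], [-2v] and [w] from the new
    factor. *)
Lemma trinomial_expand (m : nat) :
  exists (T : finType) (c : T -> F) (a b d : T -> nat),
    (forall t, (a t + b t + d t)%N = m) /\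
    forall u v w : F, (u - v *+ 2 + w) ^+ m =
      \sum_t c t * (u ^+ a t * v ^+ b t * w ^+ d t).
Proof.
elim: m => [|m [T [c [a [b [d [Hdeg HT]]]]]]].
  exists unit, (fun=> 1), (fun=> 0%N), (fun=> 0%N), (fun=> 0%N); split=> // u v w.
  by rewrite (bigD1 tt) //= big1 ?addr0 ?mulr1 // => -[].
exists (T * option bool)%type.
exists (fun p => if p.2 == Some true then - c p.1 *+ 2 else c p.1).
exists (fun p => a p.1 + (p.2 == None))%N.
exists (fun p => b p.1 + (p.2 == Some true))%N.
exists (fun p => d p.1 + (p.2 == Some false))%N.
split=> [[t [[]|]]|u v w]; rewrite /= ?(Hdeg t) -?[in RHS](Hdeg t); try lia.
rewrite exprS HT big_distrr /=.
rewrite -(pair_bigA _ (fun t o => (if o == Some true then - c t *+ 2 else c t) *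
  (u ^+ (a t + (o == None)) * v ^+ (b t + (o == Some true)) *
   w ^+ (d t + (o == Some false))))) /=.
apply: eq_bigr => t _.
rewrite (bigD1 None) //= (bigD1 (Some true)) //= (bigD1 (Some false)) //=.
rewrite big1 ?addr0; last by case=> [[]|].
by rewrite !addn0 !addn1 !exprS; ring.
Qed.

(** In the field, [1 - a^(q-1)] is the indicator of [a = 0]; the index [None] carries the constant
    1. *)
Lemma eg_expand :
  exists (T : finType) (c : T -> F) (a b d : T -> 'I_q.-1.+1),
    (forall t, (a t + b t + d t <= q.-1)%N) /\
    forall u v w : F, (u - v *+ 2 + w == 0)%:R =
      \sum_t c t * (u ^+ a t * v ^+ b t * w ^+ d t).
Proof.
have [T [c [a [b [d [Hdeg HT]]]]]] := trinomial_expand q.-1.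
pose lift (f : T -> nat) (o : option T) : 'I_q.-1.+1 :=
  if o is Some t then inord (f t) else ord0.
exists (option T), (fun o => if o is Some t then - c t else 1).
exists (lift a), (lift b), (lift d).
have la t : (inord (a t) : 'I_q.-1.+1) = a t :> nat.
  by rewrite inordK // ltnS -(Hdeg t); clear; lia.
have lb t : (inord (b t) : 'I_q.-1.+1) = b t :> nat.
  by rewrite inordK // ltnS -(Hdeg t); clear; lia.
have ld t : (inord (d t) : 'I_q.-1.+1) = d t :> nat.
  by rewrite inordK // ltnS -(Hdeg t); clear; lia.
split=> [[t|]|u v w] //=; first by rewrite la lb ld Hdeg.
have -> : (u - v *+ 2 + w == 0)%:R = 1 - (u - v *+ 2 + w) ^+ q.-1.
  by rewrite finField_expf_pred; case: eqP; rewrite ?subr0 ?subrr.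
rewrite (bigD1 None) //= !mulr1; congr (_ + _).
rewrite HT -sumrN [RHS](reindex_omap Some id) /=; last by case.
apply: eq_big => [t|t _]; first by rewrite eqxx.
by rewrite mulNr la lb ld.
Qed.

Definition small_exps (n : nat) : {set {ffun 'I_n -> 'I_q.-1.+1}} :=
  [set g : {ffun 'I_n -> 'I_q.-1.+1} | (3 * \sum_l g l <= q.-1 * n)%N].

Lemma rV_eq_prod n (x y z : 'rV[F]_n) :
  (x - y *+ 2 + z == 0)%:R =
  \prod_l (x 0 l - y 0 l *+ 2 + z 0 l == 0)%:R :> F.
Proof.
case: eqP => [H|H].
  rewrite big1 // => l _; move/rowP/(_ l): H; rewrite !mxE => H.
  by rewrite (_ : _ + _ = 0) ?eqxx // -H mulr2n.
case: (pickP (fun l => x 0 l - y 0 l *+ 2 + z 0 l != 0)) => [l Hl|HH].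
  by rewrite (bigD1 l) //= (negbTE Hl) mul0r.
case: H; apply/rowP => l; have /negPn/eqP H := negbT (HH l).
by rewrite !mxE -[RHS]H mulr2n.
Qed.

Lemma ap_free_eq n (S : {set 'rV[F]_n}) x y z : ap_free 3 S ->
  x \in S -> y \in S -> z \in S -> (x - y *+ 2 + z == 0) = (x == y) && (y == z).
Proof.
move=> /forallP/(_ x)/forallP/(_ (y - x)) HS xS yS zS.
apply/eqP/andP => [H|[/eqP-> /eqP->]]; last first.
  by rewrite mulr2n opprD addrA subrr add0r addrC subrr.
have zE : z = x + (y - x) *+ 2.
  apply/eqP; rewrite -subr_eq0 mulrnBl !mulr2n; apply/eqP; rewrite -[RHS]H mulr2n.
  by apply/rowP => l; rewrite !mxE; ring.
have xy : y = x.
  apply/eqP; rewrite -subr_eq0; apply/negPn/negP => d0.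
  move: HS; rewrite d0 /= => /negP; apply; apply/fintype.subsetP => t.
  case/imsetP => -[[|[|[|//]]] i3] _ -> /=.
  - by rewrite mulr0n addr0.
  - by rewrite mulr1n addrC subrK.
  - by rewrite -zE.
by rewrite zE xy subrr mul0rn addr0.
Qed.

(** Multiplying the indicators over all coordinates gives monomials of total degree at most
    [(q-1)n], so the exponents of [x], of [y] or of [z] sum to at most a third of that. Grouping by
    the first variable with this property ([S1], [S2], [S3]) cuts the diagonal tensor on [S] into
    slices. *)
Theorem ap_free_small_exps n (S : {set 'rV[F]_n}) : ap_free 3 S ->
  (#|S| <= 3 * #|small_exps n|)%N.
Proof.
move=> apS; have [T [c [a [b [d [Hdeg HT]]]]]] := eg_expand.
pose ex (e : T -> 'I_q.-1.+1) (f : {ffun 'I_n -> T}) : {ffun 'I_n -> 'I_q.-1.+1} :=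
  [ffun l => e (f l)].
pose X (x : 'rV[F]_n) (g : {ffun 'I_n -> 'I_q.-1.+1}) : F := \prod_l x 0 l ^+ g l.
pose cf (f : {ffun 'I_n -> T}) := \prod_l c (f l).
pose S1 f := ex a f \in small_exps n.
pose S2 f := ~~ S1 f && (ex b f \in small_exps n).
pose S3 f := ~~ S1 f && ~~ (ex b f \in small_exps n).
have S3P f : S3 f -> ex d f \in small_exps n.
  rewrite /S3 /S1 !inE -!ltnNge => /andP[H1 H2].
  have : (\sum_l (ex a f l + ex b f l + ex d f l) <= \sum_(l < n) q.-1)%N.
    by apply: leq_sum => l _; rewrite !ffunE.
  rewrite !big_split sum_nat_const card_ord /= mulnC; move: H1 H2.
  move: (\sum_i ex a f i)%N (\sum_i ex b f i)%N (\sum_i ex d f i)%N => A B D.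
  by move: (q.-1 * n)%N => Q; clear; lia.
apply: (@slice_rank_diagonal_set F _ _ S (small_exps n) X
  (fun g y z => \sum_(f | S1 f && (ex a f == g)) cf f * (X y (ex b f) * X z (ex d f)))
  (fun g x z => \sum_(f | S2 f && (ex b f == g)) cf f * (X x (ex a f) * X z (ex d f)))
  (fun g x y => \sum_(f | S3 f && (ex d f == g)) cf f * (X x (ex a f) * X y (ex b f)))).
move=> x y z xS yS zS; rewrite -(ap_free_eq apS) // rV_eq_prod.
under eq_bigr do rewrite HT.
rewrite bigA_distr_bigA /= (bigID S1) /= -addrA; congr (_ + _).
  rewrite (partition_big (ex a) (mem (small_exps n))) //=.
  apply: eq_bigr => g _; rewrite big_distrr /=; apply: eq_bigr => f /andP[_ /eqP <-].
  rewrite /cf /X -!big_split /=; apply: eq_bigr => l _; rewrite !ffunE; ring.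
rewrite (bigID (fun f => ex b f \in small_exps n)) /=; congr (_ + _).
  rewrite (partition_big (ex b) (mem (small_exps n))) //=; last by move=> f /andP[].
  apply: eq_bigr => g _; rewrite big_distrr /=; apply: eq_bigr => f /andP[_ /eqP <-].
  rewrite /cf /X -!big_split /=; apply: eq_bigr => l _; rewrite !ffunE; ring.
rewrite (partition_big (ex d) (mem (small_exps n))) //=.
apply: eq_bigr => g _; rewrite big_distrr /=; apply: eq_bigr => f /andP[_ /eqP <-].
rewrite /cf /X -!big_split /=; apply: eq_bigr => l _; rewrite !ffunE; ring.
Qed.

End EllenbergGijswijt.

(** * Bounds on the Ellenberg-Gijswijt constant *)

Section EGConstant.
Variables (R : realType) (q : nat).
Hypothesis q_gt1 : (1 < q)%N.

Definition eg_ratio (y : R) : R := (\sum_(i < q) y ^+ i) / y `^ ((q%:R - 1) / 3).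

Lemma eg_sum_ge1 (y : R) : 0 < y -> 1 <= \sum_(i < q) y ^+ i.
Proof.
move=> y0; rewrite -(prednK (ltnW q_gt1)) big_ord_recl expr0 lerDl.
by apply: sumr_ge0 => i _; rewrite exprn_ge0 // ltW.
Qed.

Lemma eg_ratio_gt0 (y : R) : 0 < y -> 0 < eg_ratio y.
Proof.
move=> y0; rewrite divr_gt0 ?powR_gt0 //.
exact: lt_le_trans (eg_sum_ge1 y0).
Qed.

Lemma EG_inf_le (y : R) : 0 < y -> y < 1 -> EG_inf R q <= eg_ratio y.
Proof.
move=> y0 y1; apply: ge_inf; last by exists y => //=; rewrite in_itv /= y0.
exists 0; move=> r [z /=]; rewrite in_itv /= => /andP[z0 _] <-.
exact/ltW/eg_ratio_gt0.
Qed.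

Lemma EG_inf_ge (a : R) :
  (forall y, 0 < y -> y < 1 -> a <= eg_ratio y) -> a <= EG_inf R q.
Proof.
move=> Ha; apply: lb_le_inf; last first.
  by move=> r [y /=]; rewrite in_itv /= => /andP[y0 y1] <-; apply: Ha.
exists (eg_ratio 2^-1); exists 2^-1 => //=.
by rewrite in_itv /= invr_gt0 ltr0n /= invf_lt1 ?ltr1n.
Qed.

(** Taking [n]-th roots carries a bound valid for every [y] through the infimum. *)
Lemma EG_inf_ge_root (a : R) (n : nat) : (0 < n)%N -> 0 <= a ->
  (forall y, 0 < y -> y < 1 -> a <= eg_ratio y ^+ n) -> a <= EG_inf R q ^+ n.
Proof.
move=> n0 a0 Ha; have n0R : n%:R != 0 :> R by rewrite pnatr_eq0 -lt0n.
have aE : a = (a `^ n%:R^-1) ^+ n.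
  by rewrite -powR_mulrn ?powR_ge0 // -powRrM mulVf // powRr1.
have le_root : a `^ n%:R^-1 <= EG_inf R q.
  apply: EG_inf_ge => y y0 y1; have r0 := ltW (eg_ratio_gt0 y0).
  have -> : eg_ratio y = (eg_ratio y ^+ n) `^ n%:R^-1.
    by rewrite -powR_mulrn // -powRrM mulfV // powRr1.
  by apply: ge0_ler_powR; rewrite ?invr_ge0 ?nnegrE ?exprn_ge0 ?Ha.
by rewrite aE; apply: lerXn2r; rewrite ?nnegrE ?powR_ge0 // (le_trans _ le_root) ?powR_ge0.
Qed.

Lemma q_gt1R : 1 < q%:R :> R. Proof. by rewrite ltr1n. Qed.

(** AM-GM on the paired terms: [y^i + y^(q-1-i) >= 2 s^(q-1)] with [s] the square root of [y]. *)
Lemma eg_sqr_ge (y : R) : 0 < y ->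
  q%:R ^+ 2 * y ^+ q.-1 <= (\sum_(i < q) y ^+ i) ^+ 2.
Proof.
move=> y0; pose s := Num.sqrt y.
have s0 : 0 <= s by exact: sqrtr_ge0.
have sy : y = s ^+ 2 by rewrite sqr_sqrtr // ltW.
have -> : q%:R ^+ 2 * y ^+ q.-1 = (q%:R * s ^+ q.-1) ^+ 2.
  by rewrite exprMn sy -!exprM mulnC.
rewrite lerXn2r ?nnegrE ?mulr_ge0 ?exprn_ge0 ?(le_trans ler01 (eg_sum_ge1 y0)) //.
rewrite -(ler_pM2l (ltr0Sn R 1)).
have -> : 2 * \sum_(i < q) y ^+ i = \sum_(i < q) (y ^+ i + y ^+ (q.-1 - i)).
  rewrite big_split /= mulr_natl mulr2n; congr (_ + _).
  rewrite (reindex_inj rev_ord_inj) /=; apply: eq_bigr => i _.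
  by rewrite subnS -subn1 -subnDA addnC subnDA subn1.
have -> : 2 * (q%:R * s ^+ q.-1) = \sum_(i < q) (s ^+ q.-1 *+ 2).
  by rewrite sumr_const card_ord -[RHS]mulr_natl; ring.
apply: ler_sum => i _; have iq : (i <= q.-1)%N by have := ltn_ord i; lia.
have -> : s ^+ q.-1 = s ^+ i * s ^+ (q.-1 - i) by rewrite -exprD subnKC.
rewrite sy -!exprM !(mulnC 2) !exprM.
by have := sqr_ge0 (s ^+ i - s ^+ (q.-1 - i)); rewrite sqrrB; lra.
Qed.

Lemma EG_inf_ge1 : 1 <= EG_inf R q.
Proof.
apply: EG_inf_ge => y y0 y1; rewrite ler_pdivlMr ?powR_gt0// mul1r.
apply: le_trans (eg_sum_ge1 y0).
rewrite -[leRHS](powRr0 y); apply: ger_powR; first by rewrite y0 ltW.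
by rewrite divr_ge0// subr_ge0 ler1n ltnW.
Qed.

Lemma pow_eg_exponent (y : R) (n : nat) : 0 <= y ->
  (y `^ ((q%:R - 1) / 3)) ^+ n = y `^ ((q.-1 * n)%:R / 3).
Proof.
move=> y0; rewrite -powR_mulrn ?powR_ge0 // -powRrM; congr (_ `^ _).
rewrite natrM -[q in q%:R - 1](prednK (ltnW q_gt1)) -natr1; lra.
Qed.

(** In logarithms to base [q] this is [1 - c >= 2/3]. Cubing turns the denominator into [y^(q-1)];
    one of the three numerator factors is bounded below by 1. *)
Lemma EG_inf_cube_ge : q%:R ^+ 2 <= EG_inf R q ^+ 3.
Proof.
apply: EG_inf_ge_root => // y y0 y1.
have S1 := eg_sum_ge1 y0.
rewrite /eg_ratio expr_div_n pow_eg_exponent ?(ltW y0) // natrM mulfK //.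
rewrite powR_mulrn ?(ltW y0) // ler_pdivlMr ?exprn_gt0 //.
apply: le_trans (eg_sqr_ge y0) _; rewrite [leRHS]exprS ler_peMl //.
by rewrite exprn_ge0 // (le_trans ler01).
Qed.

Lemma ln_q_gt0 : 0 < ln q%:R :> R. Proof. by rewrite ln_gt0 // q_gt1R. Qed.

Lemma c_le : c_ R q <= 1 / 3.
Proof.
have E1 := EG_inf_ge1; have E0 : 0 < EG_inf R q by exact: lt_le_trans E1.
have q0 : 0 < q%:R :> R by exact: lt_trans q_gt1R.
have : ln (q%:R ^+ 2) <= ln (EG_inf R q ^+ 3).
  by rewrite ler_ln ?posrE ?exprn_gt0 ?EG_inf_cube_ge.
rewrite !lnXn // => H.
have : 2 / 3 <= ln (EG_inf R q) / ln q%:R.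
  by rewrite ler_pdivlMr ?ln_q_gt0 //; lra.
by rewrite /c_; lra.
Qed.

(** From [exp(-x) >= 1 - x], as [(1 - x)(1 + x + 2x^2) = 1 + x^2 (1 - 2x)]. *)
Lemma expR_le_quadratic (x : R) : x <= 1 / 2 -> expR x <= 1 + x + 2 * x ^+ 2.
Proof.
move=> x12; have := expR_ge1Dx (- x); rewrite expRN => H.
have e0 := expR_gt0 x.
have : (1 - x) * expR x <= 1 by rewrite -ler_pdivlMr // mul1r.
move=> H1; have p : 0 < 1 - x by lra.
rewrite -(ler_pM2l p); apply: le_trans H1 _.
have := sqr_ge0 x; rewrite [x ^+ 2]expr2; nra.
Qed.

(** At [y = 1] the ratio equals [q]. Putting [y = exp(-3s)] turns it into the sum of [exp(s k_i)]
    with [k_i = q - 1 - 3i], whose derivative at [s = 0] is [-q(q-1)/2]; at [s = 1/(64q)] the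
    quadratic error does not cancel this gain. *)
Lemma EG_inf_lt : EG_inf R q < q%:R.
Proof.
have q0 : 0 < q%:R :> R by exact: lt_trans q_gt1R.
have q2 : 2 <= q%:R :> R by rewrite ler_nat.
pose s : R := (64 * q%:R)^-1.
have s0 : 0 < s by rewrite invr_gt0 mulr_gt0.
have sq : s * q%:R = 64^-1 by rewrite /s; field; rewrite gt_eqF.
pose k (i : 'I_q) : R := q%:R - 1 - 3 * i%:R.
have le_k i : `|k i| <= 2 * q%:R.
  have iq : i%:R <= q%:R - 1 :> R.
    by rewrite lerBrDr natr1 ler_nat.
  have i0 : 0 <= i%:R :> R by [].
  by rewrite /k ler_norml; apply/andP; split; lra.
have sum_k : \sum_i k i = - (q%:R * (q%:R - 1) / 2).
  have : \sum_i (k i + k (rev_ord i)) = \sum_(i < q) (- (q%:R - 1)).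
    apply: eq_bigr => i _; rewrite /k /= natrB ?ltn_ord // -natr1; lra.
  have rev_k : \sum_i k (rev_ord i) = \sum_i k i.
    by rewrite [RHS](reindex_inj rev_ord_inj).
  rewrite big_split /= rev_k sumr_const card_ord.
  by rewrite -[_ *+ q]mulr_natl; lra.
have y1 : expR (- (3 * s)) < 1 by rewrite expR_lt1 oppr_lt0 mulr_gt0.
apply: le_lt_trans (EG_inf_le (expR_gt0 _) y1) _.
have -> : eg_ratio (expR (- (3 * s))) = \sum_i expR (s * k i).
  rewrite /eg_ratio -expRM big_distrl /=; apply: eq_bigr => i _.
  rewrite -expRM_natl -expRN -expRD; congr expR; rewrite /k; lra.
apply: (@le_lt_trans _ _ (\sum_i (1 + s * k i + s ^+ 2 * (8 * q%:R ^+ 2)))).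
  apply: ler_sum => i _; have /ler_normlP[k1 k2] := le_k i.
  apply: le_trans (expR_le_quadratic _) _.
    have : s * k i <= s * (2 * q%:R) by rewrite ler_pM2l.
    rewrite mulrCA sq; lra.
  rewrite lerD2l exprMn mulrCA ler_wpM2l ?sqr_ge0 //.
  have : k i ^+ 2 <= (2 * q%:R) ^+ 2.
    by rewrite -real_normK ?num_real // lerXn2r ?nnegrE ?mulr_ge0.
  rewrite exprMn; lra.
rewrite !big_split /= -big_distrr /= sum_k !sumr_const card_ord.
rewrite -[_ *+ q]mulr_natl mulr1.
have -> : s ^+ 2 * (8 * q%:R ^+ 2) *+ q = (8 / 64) * s * q%:R * q%:R.
  rewrite -mulr_natl.
  transitivity (8 * (s * q%:R) * s * q%:R * q%:R); first by ring.
  by rewrite sq; ring.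
have : 0 < s * q%:R by rewrite sq invr_gt0.
nra.
Qed.

Lemma c_gt0 : 0 < c_ R q.
Proof.
have E0 : 0 < EG_inf R q by exact: lt_le_trans EG_inf_ge1.
rewrite /c_ subr_gt0 ltr_pdivrMr ?ln_q_gt0 // mul1r ltr_ln ?posrE ?EG_inf_lt //.
exact: lt_trans q_gt1R.
Qed.

Lemma powR_EG (n : nat) : q%:R `^ (n%:R * (1 - c_ R q)) = EG_inf R q ^+ n.
Proof. by rewrite mulrC powRrM powR_c_ // powR_mulrn // (le_trans ler01 EG_inf_ge1). Qed.

End EGConstant.

(** Rankin's trick: for [0 < y < 1] each vector of [small_exps] contributes at least [y^((q-1)n/3)]
    to the expansion of [(1 + ... + y^(q-1))^n], so the [n]-th power of the ratio bounds their
    number for every [y]. *)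
Lemma ap_free_le (R : realType) (F : finFieldType) (n : nat) (S : {set 'rV[F]_n}) :
  ap_free 3 S -> #|S|%:R <= 3 * #|F|%:R `^ (n%:R * (1 - c_ R #|F|)) :> R.
Proof.
move=> /ap_free_small_exps SE; have q1 : (1 < #|F|)%N by exact: finRing_gt1.
apply: (@le_trans _ _ (3 * #|small_exps F n|%:R)).
  by rewrite -natrM ler_nat.
rewrite ler_pM2l // powR_EG //.
case: n S SE => [|n] S _.
  rewrite expr0 lern1 (_ : 1 = #|{: {ffun 'I_0 -> 'I_#|F|.-1.+1}}|)%N; last first.
    by rewrite card_ffun !card_ord.
  exact: max_card.
apply: EG_inf_ge_root => // y y0 y1.
rewrite /eg_ratio expr_div_n pow_eg_exponent ?(ltW y0) //.
rewrite ler_pdivlMr ?powR_gt0 // -[in X in X ^+ _](prednK (ltnW q1)).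
rewrite -[in leRHS](card_ord n.+1) -prodr_const bigA_distr_bigA /=.
apply: (@le_trans _ _ (\sum_(g in small_exps F n.+1) \prod_l y ^+ g l)).
  set b := (X in _ * X); have -> : #|small_exps F n.+1|%:R * b =
      \sum_(g in small_exps F n.+1) b by rewrite sumr_const mulr_natl.
  apply: ler_sum => g; rewrite inE => Hg.
  rewrite prodrXr -powR_mulrn ?(ltW y0) //.
  apply: ger_powR; first by rewrite y0 ltW.
  rewrite ler_pdivlMr // -natrM ler_nat mulnC; exact: Hg.
rewrite [leRHS](bigID (mem (small_exps F n.+1))) /= lerDl.
by apply: sumr_ge0 => f _; apply: prodr_ge0 => l _; rewrite exprn_ge0 // ltW.
Qed.

(** * The law of a random subset *)

Section LawOfRandomSubset.
Local Open Scope classical_set_scope.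
Context {R : realType} {d : measure_display} {T : measurableType d}.
Variables (P : probability T R) (V : finType) (p : R) (B : T -> {set V}).
Hypothesis HB : binomial_random_subset P p B.

Definition law (S : {set V}) : R := fine (P [set w | B w = S]).

Lemma measurable_eq_set (S : {set V}) : measurable [set w | B w = S].
Proof.
case: HB => mB _ _.
rewrite (_ : [set w | B w = S] = \bigcap_(x in [set: V])
  (if x \in S then [set w | x \in B w] else ~` [set w | x \in B w])).
  apply: fin_bigcap_measurable => [|x _]; first exact: finite_finset.
  by case: ifP => _ //; apply: measurableC.
apply/seteqP; split=> w /=; first by move=> wS x _; case: ifP => /=; rewrite wS // => ->.
move=> H; apply/setP => x; have := H x I; case: ifP => //= _.
by move/negP/negbTE.
Qed.

Lemma law_ge0 S : 0 <= law S.
Proof. exact/fine_ge0/measure_ge0. Qed.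

Lemma prob_law (Q : pred {set V}) :
  P [set w | Q (B w)] = (\sum_(S | Q S) law S)%:E.
Proof.
rewrite (_ : [set w | Q (B w)] =
  \bigcup_(S in [set` enum Q]) [set w | B w = S]); last first.
  apply/seteqP; split=> w /=; last by move=> [S /=]; rewrite mem_enum => QS ->.
  by move=> QB; exists (B w) => //=; rewrite mem_enum.
rewrite measure_fin_bigcup; last 3 first.
- exact: finite_seq.
- by move=> S S' _ _ [w [/= <- <-]].
- by move=> S _; exact: measurable_eq_set.
rewrite -fsbig_seq ?enum_uniq // big_enum /= -sumEFin; apply: eq_bigr => S _.
by rewrite /law fineK // fin_num_measure //; exact: measurable_eq_set.
Qed.

Lemma law_sum1 : \sum_S law S = 1.
Proof.
apply: EFin_inj; rewrite -(prob_law xpredT) -[RHS](probability_setT P).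
by congr (P _); apply/seteqP; split.
Qed.

(** Independence enters only here: all moment and tail bounds below use it through these inclusion
    probabilities. *)
Lemma law_superset (J : {set V}) : \sum_(S : {set V} | J \subset S) law S = p ^+ #|J|.
Proof.
case: HB => _ pB iB; apply: EFin_inj; rewrite -(prob_law (fun S : {set V} => J \subset S)).
transitivity (P (\bigcap_(x in [set` J]) [set w | x \in B w])).
  congr (P _); apply/seteqP; split=> w /=.
    by move=> /fintype.subsetP JB x /= /JB.
  by move=> H; apply/fintype.subsetP => x xJ; apply: H.
rewrite iB (eq_bigr (fun=> p%:E)) => [|x _]; last exact: pB.
rewrite prodEFin prodr_const //.
Qed.

End LawOfRandomSubset.

(** * Moments and tails from inclusion probabilities *)

Section FiniteLaw.
Variables (R : realType) (V : finType) (p : R) (mu : {set V} -> R).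
Hypothesis mu_ge0 : forall S, 0 <= mu S.
Hypothesis mu_sum1 : \sum_S mu S = 1.
Hypothesis mu_superset : forall J : {set V}, \sum_(S : {set V} | J \subset S) mu S = p ^+ #|J|.

Lemma law_mean : \sum_S mu S * #|S|%:R = #|V|%:R * p.
Proof.
transitivity (\sum_(S : {set V}) \sum_(x : V | x \in S) mu S).
  by apply: eq_bigr => S _; rewrite sumr_const mulr_natr.
rewrite (exchange_big_dep xpredT) //= (eq_bigr (fun=> p)).
  by rewrite sumr_const mulr_natl.
move=> x _; rewrite -[RHS]expr1 -(cards1 x) -mu_superset.
by apply: eq_bigl => S; rewrite finset.sub1set.
Qed.

Lemma law_second_moment :
  \sum_S mu S * #|S|%:R ^+ 2 <= (#|V|%:R * p) ^+ 2 + #|V|%:R * p.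
Proof.
have p2 x y : \sum_(S : {set V} | (x \in S) && (y \in S)) mu S = p ^+ #|[set x; y]|.
  by rewrite -mu_superset; apply: eq_bigl => S; rewrite finset.subUset !finset.sub1set.
have -> : \sum_S mu S * #|S|%:R ^+ 2 = \sum_(x : V) \sum_(y : V) p ^+ #|[set x; y]|.
  transitivity (\sum_(S : {set V}) \sum_(x in S) \sum_(y in S) mu S).
    apply: eq_bigr => S _; under eq_bigr do rewrite sumr_const.
    by rewrite sumr_const expr2 mulrA !mulr_natr.
  rewrite (exchange_big_dep xpredT) //=; apply: eq_bigr => x _.
  rewrite (exchange_big_dep xpredT) //=; apply: eq_bigr => y _; exact: p2.
apply: (@le_trans _ _ (\sum_(x : V) (#|V|%:R * p ^+ 2 + p))); last first.
  by rewrite sumr_const -mulr_natl; rewrite le_eqVlt; apply/orP; left; apply/eqP; ring.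
apply: ler_sum => x _; rewrite (bigD1 x) //= finset.setUid cards1 expr1 addrC lerD2r.
apply: (@le_trans _ _ (\sum_(y : V | y != x) p ^+ 2)).
  by apply: ler_sum => y yx; rewrite cards2 eq_sym yx.
rewrite sumr_const -[leLHS]mulr_natl ler_wpM2r ?sqr_ge0 // ler_nat; exact: max_card.
Qed.

Lemma markov_card (a : R) : 0 < a ->
  \sum_(S : {set V} | a < #|S|%:R) mu S <= #|V|%:R * p / a.
Proof.
move=> a0; rewrite ler_pdivlMr // -law_mean big_distrl /=.
rewrite [leRHS](bigID (fun S : {set V} => a < #|S|%:R)) /=.
rewrite -[leLHS]addr0; apply: lerD.
  by apply: ler_sum => S aS; rewrite ler_wpM2l // ltW.
by apply: sumr_ge0 => S _; rewrite mulr_ge0.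
Qed.

Lemma chebyshev_card : 0 < #|V|%:R * p ->
  \sum_(S : {set V} | #|S|%:R < #|V|%:R * p / 2) mu S <= 4 / (#|V|%:R * p).
Proof.
set m := #|V|%:R * p => m0.
have var : \sum_S mu S * (#|S|%:R - m) ^+ 2 <= m.
  have -> : \sum_S mu S * (#|S|%:R - m) ^+ 2 =
      \sum_S mu S * #|S|%:R ^+ 2 - 2 * m * (\sum_S mu S * #|S|%:R)
      + m ^+ 2 * \sum_S mu S.
    by rewrite !big_distrr -sumrN -!big_split /=; apply: eq_bigr => S _; ring.
  by rewrite law_mean mu_sum1 -/m; have := law_second_moment; rewrite -/m; nra.
have m2 : 0 < m ^+ 2 / 4 by rewrite divr_gt0 ?exprn_gt0.
rewrite -(ler_pM2r m2) (_ : 4 / m * (m ^+ 2 / 4) = m); last first.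
  by field; rewrite gt_eqF.
apply: le_trans var; rewrite big_distrl /=.
rewrite [leRHS](bigID (fun S : {set V} => #|S|%:R < m / 2)) /=.
rewrite -[leLHS]addr0; apply: lerD; last first.
  by apply: sumr_ge0 => S _; rewrite mulr_ge0 ?sqr_ge0.
by apply: ler_sum => S Sm; rewrite ler_wpM2l //; nra.
Qed.

(** First moment: a set meeting [C] in at least [M] points contains one of the [M]-subsets of [C],
    each of which it contains with probability [p^M]. *)
Lemma card_draws_superset (C : {set V}) (M : nat) :
  \sum_(S : {set V} | (M <= #|S :&: C|)%N) mu S <= 'C(#|C|, M)%:R * p ^+ M.
Proof.
apply: (@le_trans _ _ (\sum_(S : {set V})
    \sum_(J : {set V} | [&& J \subset C, #|J| == M & J \subset S]) mu S)).
  rewrite [leRHS](bigID (fun S : {set V} => M <= #|S :&: C|)%N) /=.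
  rewrite -[leLHS]addr0; apply: lerD; last first.
    by apply: sumr_ge0 => S _; apply: sumr_ge0.
  apply: ler_sum => S MS; pose J := [set x in take M (enum (S :&: C))].
  have JSC : J \subset S :&: C.
    by apply/fintype.subsetP => x; rewrite inE => /mem_take; rewrite mem_enum.
  rewrite (bigD1 J) /= ?lerDl ?sumr_ge0 //.
  move: JSC; rewrite finset.subsetI => /andP[-> ->]; rewrite andbT /=.
  rewrite cardsE (card_uniqP _) ?take_uniq ?enum_uniq //.
  by rewrite size_takel // -cardE.
rewrite (exchange_big_dep (fun J : {set V} => (J \subset C) && (#|J| == M))) /=; last first.
  by move=> S J _ /and3P[-> ->].
rewrite (eq_bigr (fun=> p ^+ M)); last first.
  move=> J /andP[JC /eqP JM]; rewrite -JM -mu_superset; apply: eq_bigl => S.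
  by rewrite JC eqxx.
rewrite sumr_const mulr_natl -cards_draws le_eqVlt; apply/orP; left.
by apply/eqP; congr (_ *+ _); apply: eq_card => J; rewrite !inE.
Qed.

End FiniteLaw.

(** * Supersaturation and sparse containers *)

Section Supersaturation.
Variable F : finFieldType.

Definition ap_pairs n (A : {set 'rV[F]_n}) : {set 'rV[F]_n * 'rV[F]_n} :=
  [set xd | [&& xd.2 != 0, xd.1 \in A, xd.1 + xd.2 \in A & xd.1 + xd.2 *+ 2 \in A]].

Lemma ap_freePn n (S : {set 'rV[F]_n}) : ~~ ap_free 3 S ->
  exists xd, xd \in ap_pairs S.
Proof.
rewrite negb_forall => /existsP[x]; rewrite negb_forall => /existsP[d].
rewrite negb_imply negbK => /andP[d0 /fintype.subsetP HS].
exists (x, d); rewrite inE d0 /=; apply/and3P; split; apply: HS; apply/imsetP.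
- by exists ord0; rewrite // mulr0n addr0.
- by exists (inord 1); rewrite // inordK.
- by exists (inord 2); rewrite // inordK.
Qed.

(** Delete the first term of a nontrivial progression until none is left: every deletion destroys at
    least one pair. *)
Lemma card_le_ap_pairs (R : realType) n (b : R) :
  (forall S : {set 'rV[F]_n}, ap_free 3 S -> #|S|%:R <= b) ->
  forall S : {set 'rV[F]_n}, #|S|%:R <= #|ap_pairs S|%:R + b.
Proof.
move=> Hb S; have [k] := ubnP #|S|; elim: k S => // k IH S Sk.
have [/Hb SF|/ap_freePn[[x d] xd]] := boolP (ap_free 3 S).
  by apply: le_trans SF _; rewrite lerDr.
have xS : x \in S by move: xd; rewrite inE => /and4P[].
have c1 : #|S| = (#|S :\ x| + 1)%N by rewrite [LHS](cardsD1 x) xS addnC.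
have := IH (S :\ x); rewrite -ltnS -[X in (X < _)%N]addn1 -c1 => /(_ Sk) IHS.
have : (#|ap_pairs (S :\ x)| + 1 <= #|ap_pairs S|)%N.
  rewrite [leqRHS](cardsD1 (x, d)) xd addnC leq_add2l; apply: subset_leq_card.
  apply/fintype.subsetP => -[y e]; rewrite !inE /= => /and4P[-> /andP[yx ->]].
  move=> /andP[_ ->] /andP[_ ->]; rewrite !andbT.
  by apply: contra yx => /eqP[->].
by rewrite -(ler_nat R) c1 !natrD; lra.
Qed.

Section Average.
Variables (m n : nat) (A : {set 'rV[F]_n}).

(** The difference [w = 0] is allowed, since a random matrix may kill a nonzero difference; it
    accounts for the extra [#|A|] below. *)
Definition ap_starts (w : 'rV[F]_n) : nat :=
  (\sum_(b : 'rV[F]_n) [&& b \in A, b + w \in A & b + w *+ 2 \in A]%R)%N.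

Lemma sum_ap_starts : (\sum_w ap_starts w = #|ap_pairs A| + #|A|)%N.
Proof.
rewrite (bigD1 0) //= addnC; congr addn; last first.
  rewrite /ap_starts -sum1_card [RHS]big_mkcond /=; apply: eq_bigr => b _.
  by rewrite mul0rn addr0; case: (b \in A).
rewrite /ap_starts exchange_big pair_big /= -sum1_card big_mkcond.
rewrite [RHS]big_mkcond; apply: eq_bigr => -[b w] _ /=; rewrite inE /=.
by case: eqP; case: (b \in A); case: (_ \in A); case: (_ \in A).
Qed.

(* Every matrix M0 with [d *m M0 = w0] shifts the sum over M by w0. *)
Lemma sum_mulmx_row (g : 'rV[F]_n -> nat) (d : 'rV[F]_m) : d != 0 ->
  (#|'rV[F]_n| * \sum_(M : 'M[F]_(m, n)) g (d *m M) =
   #|'M[F]_(m, n)| * \sum_w g w)%N.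
Proof.
move=> d0; have dfree : row_free d by rewrite /row_free rank_rV d0.
have shift w0 : (\sum_(M : 'M[F]_(m, n)) g (d *m M) =
    \sum_(M : 'M[F]_(m, n)) g (w0 + d *m M)%R)%N.
  rewrite (reindex_inj (addrI (pinvmx d *m w0))) /=; apply: eq_bigr => M _.
  by rewrite mulmxDr mulmxA mulmxVp // mul1mx.
rewrite -sum_nat_const (eq_bigr _ (fun w0 _ => shift w0)) exchange_big /=.
rewrite -sum_nat_const; apply: eq_bigr => M _.
by rewrite [RHS](reindex_inj (addIr (d *m M))).
Qed.

Definition pullback (M : 'M[F]_(m, n)) (b : 'rV[F]_n) : {set 'rV[F]_m} :=
  [set u | b + u *m M \in A].

Lemma sum_pullback :
  (\sum_M \sum_b #|pullback M b| = #|'M[F]_(m, n)| * (#|'rV[F]_m| * #|A|))%N.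
Proof.
rewrite -sum_nat_const; apply: eq_bigr => M _.
transitivity (\sum_(u : 'rV[F]_m) \sum_(b : 'rV[F]_n) (b + u *m M \in A)%R)%N.
  rewrite exchange_big /=; apply: eq_bigr => b _; rewrite -sum1_card big_mkcond.
  by apply: eq_bigr => u _; rewrite inE; case: (_ \in A).
rewrite -sum_nat_const; apply: eq_bigr => u _.
rewrite -sum1_card [RHS]big_mkcond [RHS](reindex_inj (addIr (u *m M))) /=.
by apply: eq_bigr => b _; case: (_ \in A).
Qed.

(** For fixed [u] and [d != 0], summing over [b] absorbs the shift [u M], and [d M] is
    equidistributed, so each pair contributes the average of [ap_starts]. *)
Lemma sum_ap_pairs_pullback :
  (#|'rV[F]_n| * \sum_M \sum_b #|ap_pairs (pullback M b)| <=
   #|'rV[F]_m| ^ 2 * (#|'M[F]_(m, n)| * (#|ap_pairs A| + #|A|)))%N.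
Proof.
have -> : (\sum_M \sum_b #|ap_pairs (pullback M b)| =
    \sum_(u : 'rV[F]_m) \sum_(d : 'rV[F]_m | d != 0%R)
      \sum_(M : 'M[F]_(m, n)) ap_starts (d *m M))%N.
  rewrite [RHS]pair_big /= [RHS]exchange_big /=; apply: eq_bigr => M _.
  transitivity (\sum_(i : 'rV[F]_m * 'rV[F]_m | i.2 != 0%R) \sum_(b : 'rV[F]_n)
      [&& b + i.1 *m M \in A, b + i.1 *m M + i.2 *m M \in A &
          b + i.1 *m M + (i.2 *m M) *+ 2 \in A]%R)%N.
    rewrite exchange_big /=; apply: eq_bigr => b _.
    rewrite -sum1_card big_mkcond [RHS]big_mkcond /=; apply: eq_bigr => -[u d] _.
    rewrite !inE /= !mulr2n !mulmxDl !addrA.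
    by case: eqP; case: (_ \in A); case: (_ \in A); case: (_ \in A).
  apply: eq_bigr => -[u d] _ /=.
  by rewrite /ap_starts [RHS](reindex_inj (addIr (u *m M))).
rewrite big_distrr /=.
apply: (@leq_trans (\sum_(u : 'rV[F]_m) \sum_(d : 'rV[F]_m)
    (#|'M[F]_(m, n)| * (#|ap_pairs A| + #|A|)))%N); last first.
  by rewrite !sum_nat_const -mulnn mulnA.
apply: leq_sum => u _; rewrite big_distrr /= [leqRHS](bigID (fun d => d != 0)) /=.
apply: leq_trans (leq_addr _ _); apply: leq_sum => d d0.
by rewrite sum_mulmx_row // sum_ap_starts.
Qed.

Lemma supersaturation_average (R : realType) (b : R) :
  (forall S : {set 'rV[F]_m}, ap_free 3 S -> #|S|%:R <= b) ->
  #|'rV[F]_m|%:R * #|A|%:R * #|'rV[F]_n|%:R <=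
  #|'rV[F]_m|%:R ^+ 2 * (#|ap_pairs A|%:R + #|A|%:R) + #|'rV[F]_n|%:R ^+ 2 * b.
Proof.
move=> /card_le_ap_pairs Hb.
have M0 : 0 < #|'M[F]_(m, n)|%:R :> R by rewrite ltr0n; apply/card_gt0P; exists 0.
have := sum_ap_pairs_pullback; rewrite -(ler_nat R) => H1.
have H2 : (\sum_M \sum_b #|pullback M b|)%N%:R <=
    (\sum_M \sum_b #|ap_pairs (pullback M b)|)%N%:R
    + #|'M[F]_(m, n)|%:R * #|'rV[F]_n|%:R * b.
  have -> : #|'M[F]_(m, n)|%:R * #|'rV[F]_n|%:R * b =
      \sum_(M : 'M[F]_(m, n)) \sum_(b' : 'rV[F]_n) b.
    by rewrite !sumr_const -[RHS]mulr_natl -[b *+ _]mulr_natl mulrA.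
  rewrite !natr_sum -big_split /=; apply: ler_sum => M _.
  by rewrite !natr_sum -big_split /=; apply: ler_sum => b' _; apply: Hb.
rewrite sum_pullback !natrM in H2; rewrite !natrM natrD in H1.
move: H1 H2; set X := (\sum_M _)%N%:R.
set K := #|'M[F]_(m, n)|%:R in M0 *; set q' := #|'rV[F]_m|%:R.
set N := #|'rV[F]_n|%:R => H1 H2.
have N0 : 0 <= N by [].
rewrite -(ler_pM2l M0); have := ler_wpM2l N0 H2; rewrite mulrDr => H3.
apply: le_trans (_ : N * (K * (q' * #|A|%:R)) <= _).
  by rewrite le_eqVlt; apply/orP; left; apply/eqP; ring.
apply: le_trans H3 _; apply: le_trans (lerD H1 (lexx _)) _.
by rewrite le_eqVlt; apply/orP; left; apply/eqP; ring.
Qed.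

End Average.

Definition ap_rel n (x y z : 'rV[F]_n) := (x - y *+ 2 + z == 0) && (x != y).

Lemma ap_free_indep n (S : {set 'rV[F]_n}) : ap_free 3 S -> indep (@ap_rel n) S.
Proof.
move=> apS x y z xS yS zS; rewrite /ap_rel (ap_free_eq apS) //.
by case: (x == y); rewrite ?andbF.
Qed.

Lemma card_ap_pairs_le n (A : {set 'rV[F]_n}) :
  (#|ap_pairs A| <= #|triples (@ap_rel n) A|)%N.
Proof.
pose f (xd : 'rV[F]_n * 'rV[F]_n) := (xd.1, xd.1 + xd.2, xd.1 + xd.2 *+ 2).
have f_inj : injective f by move=> [x d] [y e] [-> /addrI ->].
rewrite -(card_imset _ f_inj); apply: subset_leq_card.
apply/fintype.subsetP => _ /imsetP[[x d] + ->]; rewrite !inE /=.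
move=> /and4P[d0 -> -> ->] /=; apply/andP; split.
  by apply/eqP/rowP => l; rewrite !mxE; ring.
by rewrite -subr_eq0 opprD addrA subrr sub0r oppr_eq0.
Qed.

End Supersaturation.

(** * Powers of [q^n] and their growth *)

Section Powers.
Variables (R : realType) (q : nat).
Hypothesis q_gt1 : (1 < q)%N.

Definition pw (n : nat) (a : R) : R := q%:R `^ (n%:R * a).

Let q0 : 0 < q%:R :> R. Proof. by rewrite ltr0n ltnW. Qed.

Lemma pw_gt0 n a : 0 < pw n a. Proof. exact: powR_gt0. Qed.

Lemma pw0 n : pw n 0 = 1. Proof. by rewrite /pw mulr0 powRr0. Qed.

Lemma pwD n a b : pw n (a + b) = pw n a * pw n b.
Proof. by rewrite /pw mulrDr powRD //; apply/implyP => _; rewrite gt_eqF. Qed.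

Lemma pwN n a : pw n (- a) = (pw n a)^-1.
Proof. by rewrite /pw mulrN powRN. Qed.

Lemma pw1 n : pw n 1 = (q ^ n)%:R.
Proof. by rewrite /pw mulr1 powR_mulrn ?ltW // natrX. Qed.

Lemma pw_powR n a r : pw n a `^ r = pw n (a * r).
Proof. by rewrite /pw -powRrM mulrA. Qed.

Lemma le_pw n a b : a <= b -> pw n a <= pw n b.
Proof.
move=> ab; apply: ler_powR; first by rewrite ler1n ltnW.
by rewrite ler_wpM2l.
Qed.

Lemma pw_ge1 n a : 0 <= a -> 1 <= pw n a.
Proof. by move=> a0; rewrite -(pw0 n); apply: le_pw. Qed.

(** The cube of [exp(x/3) >= x/3] beats the quadratic factor; [108 = 27 * 4] collects the cube of 3
    and [(n+1)^2 <= 4 n^2]. *)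
Lemma pw_eventually_ge (a C : R) : 0 < a ->
  exists n0, forall n, (n0 <= n)%N -> C * n.+1%:R ^+ 2 <= pw n a.
Proof.
move=> a0; pose k := a * ln q%:R; have k0 : 0 < k.
  by rewrite mulr_gt0 // ln_gt0 // ltr1n.
pose C' := Num.max C 0; pose D := 108 * C' / k ^+ 3.
exists (Num.truncn D).+1 => n Dn.
have n1 : 1 <= n%:R :> R by rewrite ler1n; apply: leq_trans Dn.
have nD : D <= n%:R.
  by apply/ltW/(lt_le_trans (truncnS_gt D)); rewrite ler_nat.
have -> : pw n a = expR (n%:R * k / 3) ^+ 3.
  by rewrite /pw /powR gt_eqF // -expRM_natl; congr expR; rewrite /k; field.
apply: (@le_trans _ _ ((n%:R * k / 3) ^+ 3)); last first.
  rewrite lerXn2r ?nnegrE ?expR_ge0 //; first by rewrite divr_ge0 // mulr_ge0 // ltW.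
  by apply: le_trans (expR_ge1Dx _); rewrite lerDr.
have C'0 : 0 <= C' by rewrite le_max lexx orbT.
apply: (@le_trans _ _ (C' * n.+1%:R ^+ 2)).
  by rewrite ler_wpM2r ?exprn_ge0 // le_max lexx.
apply: (@le_trans _ _ (C' * (4 * n%:R ^+ 2))).
  by rewrite ler_wpM2l // -natr1; nra.
move: nD; rewrite ler_pdivrMr ?exprn_gt0 // => nD.
have n2 : 0 <= n%:R ^+ 2 :> R by rewrite exprn_ge0.
have := ler_wpM2r n2 nD; rewrite !exprMn exprVn; nra.
Qed.

Lemma exists_pow_between (Y : R) : 1 <= Y ->
  exists m, Y <= (q ^ m)%:R <= q%:R * Y.
Proof.
move=> Y1; have exm : exists m, Y <= (q ^ m)%:R.
  exists (Num.truncn Y).+1; apply/ltW/(lt_le_trans (truncnS_gt Y)).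
  by rewrite ler_nat ltnW // ltn_expl.
case: (ex_minnP exm) => -[|m] Ym minm.
  by exists 0%N; rewrite Ym expn0 mulr_ege1 // ler1n ltnW.
exists m.+1; rewrite Ym expnS natrM ler_pM2l //; apply: ltW; rewrite ltNge.
by apply/negP => /minm; rewrite ltnn.
Qed.

End Powers.

Lemma powR_addn (R : realType) (w r : R) (n : nat) : 0 < w ->
  w `^ (r + n%:R) = w `^ r * w ^+ n.
Proof.
move=> w0; rewrite powRD ?powR_mulrn ?(ltW w0) //.
by apply/implyP => _; rewrite gt_eqF.
Qed.

(** The two conditions of the container step reduce to lower bounds on [s^2 w^(r-2)] and
    [s w^(r-1)]. Both grow with [w] because [r >= 3], so they need checking only at the smallest
    density [w0]. *)
Lemma density_bounds (R : realType) (r a N v e w s : R) : 3 <= r -> 0 < a -> 0 < N -> 0 < w ->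
  v <= w * N ->
  a / 2 * (N ^+ 2 * (w * w `^ r)) <= e ->
  forall w0, 0 < w0 -> w0 <= w -> 0 <= s ->
  10 * N < s ^+ 2 * (a / 2) * w0 `^ (r - 2) ->
  80 <= s * (a / 2) * w0 `^ (r - 1) -> 0 <= v ->
  10 * v ^+ 3 < s ^+ 2 * e /\ 80 * v ^+ 2 <= s * e.
Proof.
move=> c3 a0 N0 w_gt0 vN He w0 w00 w0w s0 H1 H2 v0.
have mono b : 0 <= b -> w0 `^ b <= w `^ b.
  by move=> b0; apply: ge0_ler_powR; rewrite // nnegrE ltW.
have m1 : w0 `^ (r - 2) <= w `^ (r - 2) by apply: mono; lra.
have m2 : w0 `^ (r - 1) <= w `^ (r - 1) by apply: mono; lra.
have wE2 : w `^ r = w ^+ 2 * w `^ (r - 2) by rewrite mulrC -powR_addn // subrK.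
have wE1 : w `^ r = w * w `^ (r - 1) by rewrite mulrC -[w in _ * w]expr1 -powR_addn // subrK.
have a20 : 0 <= a / 2 by rewrite divr_ge0 // ltW.
split.
  apply: (@le_lt_trans _ _ (10 * (w * N) ^+ 3)).
    by rewrite ler_pM2l // lerXn2r ?nnegrE // mulr_ge0 ?ltW.
  apply: (@lt_le_trans _ _ (s ^+ 2 * (a / 2 * (N ^+ 2 * (w * w `^ r))))); last first.
    by rewrite ler_wpM2l ?sqr_ge0.
  have H1' : 10 * N < s ^+ 2 * (a / 2) * w `^ (r - 2).
    by apply: lt_le_trans H1 _; rewrite ler_wpM2l // mulr_ge0 ?sqr_ge0.
  have K0 : 0 < w ^+ 3 * N ^+ 2 by rewrite mulr_gt0 ?exprn_gt0.
  move: H1'; rewrite -(ltr_pM2l K0) wE2 => H1'.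
  by apply: le_lt_trans (_ : _ <= w ^+ 3 * N ^+ 2 * (10 * N)) (lt_le_trans H1' _);
    rewrite le_eqVlt; apply/orP; left; apply/eqP; ring.
apply: (@le_trans _ _ (80 * (w * N) ^+ 2)).
  by rewrite ler_pM2l // lerXn2r ?nnegrE // mulr_ge0 ?ltW.
apply: (@le_trans _ _ (s * (a / 2 * (N ^+ 2 * (w * w `^ r))))); last first.
  by rewrite ler_wpM2l.
have H2' : 80 <= s * (a / 2) * w `^ (r - 1).
  by apply: le_trans H2 _; rewrite ler_wpM2l // mulr_ge0.
have K0 : 0 < w ^+ 2 * N ^+ 2 by rewrite mulr_gt0 ?exprn_gt0.
move: H2'; rewrite -(ler_pM2l K0) wE1 => H2'.
by apply: le_trans (_ : _ <= w ^+ 2 * N ^+ 2 * 80) (le_trans H2' _);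
  rewrite le_eqVlt; apply/orP; left; apply/eqP; ring.
Qed.

(** * Supersaturation and containers of prescribed density *)

Section SparseContainers.
Variables (R : realType) (F : finFieldType).
Let q := #|F|.
Let c := c_ R q.

Let q_gt1 : (1 < q)%N. Proof. exact: finRing_gt1. Qed.
Let c0 : 0 < c. Proof. exact: c_gt0. Qed.
Let c13 : c <= 1 / 3. Proof. exact: c_le. Qed.

Lemma card_rV n : #|'rV[F]_n| = (q ^ n)%N.
Proof. by rewrite card_mx mul1n. Qed.

Lemma invc_ge3 : 3 <= c^-1.
Proof. by rewrite -[3]invrK lef_pV2 ?posrE ?invr_gt0 // -[_^-1]mul1r. Qed.

(* The constant of the lower bound [e(A) >= a N^2 u^(1 + 1/c)] for sets of
   density u. *)
Definition sat_const : R := (4 * q%:R * 6 `^ c^-1)^-1.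

Lemma sat_const_gt0 : 0 < sat_const.
Proof. by rewrite invr_gt0 !mulr_gt0 ?powR_gt0 // ltr0n ltnW. Qed.

Lemma supersaturation n (A : {set 'rV[F]_n}) (u : R) : 0 < u -> u <= 1 ->
  #|A|%:R = u * (q ^ n)%:R ->
  1 <= sat_const * ((q ^ n)%:R * u `^ c^-1) ->
  sat_const * ((q ^ n)%:R ^+ 2 * (u * u `^ c^-1)) <=
    #|triples (@ap_rel F n) A|%:R.
Proof.
move=> u0 u1 Av HN.
have q0 : 0 < q%:R :> R by rewrite ltr0n ltnW.
(* For [Q = q^m >= Y] one has [Q^c >= 6/u], so the bound [3 Q^(1-c)] on AP-free sets is at most
   [Q u / 2], half the average size of a pullback. *)
pose Y := (6 / u) `^ c^-1.
have u6 : 1 <= 6 / u by rewrite ler_pdivlMr //; lra.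
have Y1 : 1 <= Y.
  by rewrite -[leLHS](powRr0 (6 / u)) ler_powR // invr_ge0 ltW.
have Y0 : 0 < Y by exact: lt_le_trans Y1.
have U0 : 0 < u `^ c^-1 by exact: powR_gt0.
have YE : Y = 6 `^ c^-1 / u `^ c^-1.
  rewrite /Y powRM ?invr_ge0 ?(ltW u0) //; congr (_ * _).
  by rewrite -powR_inv1 ?(ltW u0) // -powRrM mulN1r powRN.
have satU : sat_const * u `^ c^-1 = (4 * q%:R * Y)^-1.
  rewrite /sat_const YE; field.
  by rewrite !gt_eqF // powR_gt0.
have [m /andP[Ym mY]] := exists_pow_between q_gt1 Y1.
set Q := (q ^ m)%:R in Ym mY.
have Q0 : 0 < Q by rewrite ltr0n expn_gt0 ltnW.
have Qc : 6 / u <= Q `^ c.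
  have -> : 6 / u = Y `^ c by rewrite /Y -powRrM mulVf ?gt_eqF // powRr1 // ltW // (lt_le_trans ltr01).
  by apply: ge0_ler_powR; rewrite ?nnegrE ?(ltW c0) ?(ltW Y0) ?(ltW Q0).
have b_le : 3 * q%:R `^ (m%:R * (1 - c)) <= Q * u / 2.
  have -> : q%:R `^ (m%:R * (1 - c)) = Q / Q `^ c.
    have -> : Q = q%:R `^ m%:R by rewrite powR_mulrn ?(ltW q0) // /Q natrX.
    by rewrite mulrBr mulr1 powRB ?powRrM //; apply/implyP => _; rewrite gt_eqF.
  have Qc0 : 0 < Q `^ c by rewrite powR_gt0.
  rewrite mulrA ler_pdivrMr //.
  move: Qc; rewrite ler_pdivrMr // => Qc; nra.
have := supersaturation_average A (fun S H => @ap_free_le R F m S H).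
rewrite !card_rV -/Q Av; set N := (q ^ n)%:R; set e := #|ap_pairs A|%:R => H.
have N0 : 0 < N by rewrite ltr0n expn_gt0 ltnW.
have e_le : e <= #|triples (@ap_rel F n) A|%:R by rewrite ler_nat card_ap_pairs_le.
apply: le_trans e_le.
have -> : sat_const * (N ^+ 2 * (u * u `^ c^-1)) = N ^+ 2 * u / (4 * q%:R * Y).
  by rewrite -satU; ring.
have qY0 : 0 < q%:R * Y by rewrite mulr_gt0.
(* This keeps the term [Q u N] of the trivial progressions at most a quarter of [u N^2]. *)
have NY : 4 * (q%:R * Y) <= N.
  move: HN; rewrite -/N mulrCA satU ler_pdivlMr ?mulrA // ?mul1r //.
  by rewrite -mulrA mulr_gt0.
rewrite ler_pdivrMr -?mulrA ?mulr_gt0 //.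
have e0 : 0 <= e by [].
have H1 : Q * (u * N ^+ 2 / 2) <= Q * (Q * (e + u * N)).
  have := ler_wpM2l (sqr_ge0 N) b_le; move: H.
  set b := 3 * _; move: b => b H H'; nra.
rewrite ler_pM2l // in H1.
have QN : 4 * Q <= N by apply: le_trans NY; rewrite ler_pM2l.
have H2 : 4 * Q * (u * N) <= N * (u * N) by rewrite ler_wpM2r // mulr_ge0 ?ltW.
have H3 : Q * e <= q%:R * Y * e by rewrite ler_wpM2r.
nra.
Qed.

Lemma ap_rel_inj1 n (x x' y z : 'rV[F]_n) : ap_rel x y z -> ap_rel x' y z -> x = x'.
Proof.
move=> /andP[/eqP H1 _] /andP[/eqP H2 _].
by apply: (addIr (- (y *+ 2))); apply: (addIr z); rewrite H1 H2.
Qed.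

Lemma ap_rel_inj3 n (x y z z' : 'rV[F]_n) : ap_rel x y z -> ap_rel x y z' -> z = z'.
Proof.
move=> /andP[/eqP H1 _] /andP[/eqP H2 _].
by apply: (addrI (x - y *+ 2)); rewrite H1 H2.
Qed.

Lemma ap_rel_inj2 n (x y y' z : 'rV[F]_n) : (2%:R : F) != 0 ->
  ap_rel x y z -> ap_rel x y' z -> y = y'.
Proof.
move=> two /andP[/eqP H1 _] /andP[/eqP H2 _].
have : y *+ 2 = y' *+ 2.
  by apply: oppr_inj; apply: (addrI x); apply: (addIr z); rewrite H1 H2.
move=> /rowP H; apply/rowP => l; apply: (mulfI two).
by have := H l; rewrite !mulr_natl !mulr2n !mxE.
Qed.

Lemma card_triples_le n (A : {set 'rV[F]_n}) :
  #|triples (@ap_rel F n) A|%:R <= (q ^ n)%:R ^+ 3 :> R.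
Proof.
rewrite -natrX ler_nat; apply: leq_trans (max_card _) _.
by rewrite !card_prod card_rV !expnS expn0 muln1 mulnA.
Qed.

(** The rounds stop at [theta], half the supersaturation bound at density [w]. A set of density at
    least [w] spans at least [2 * theta] triples, so the final containers are strictly sparser. *)
Lemma sparse_family n (w : R) (s k : nat) : (2%:R : F) != 0 -> (0 < n)%N ->
  0 < w -> w <= 1 ->
  1 <= sat_const * ((q ^ n)%:R * w `^ c^-1) ->
  10 * (q ^ n)%:R < s%:R ^+ 2 * (sat_const / 2) * w `^ (c^-1 - 2) ->
  80 <= s%:R * (sat_const / 2) * w `^ (c^-1 - 1) ->
  (q ^ n)%:R ^+ 3 * (19 / 20) ^+ k <=
    sat_const / 2 * ((q ^ n)%:R ^+ 2 * (w * w `^ c^-1)) ->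
  exists Fam : {set {set 'rV[F]_n}},
  [/\ (#|Fam| <= (q ^ n) ^ ((2 * s + 4) * k))%N,
      forall C, C \in Fam -> #|C|%:R < w * (q ^ n)%:R :> R &
      forall I : {set 'rV[F]_n}, ap_free 3 I -> exists2 C, C \in Fam & I \subset C].
Proof.
move=> two n0 w0 w1 HN H1 H2 Hk.
set N := (q ^ n)%:R in HN H1 Hk *; have N0 : 0 < N by rewrite ltr0n expn_gt0 ltnW.
have a0 := sat_const_gt0.
have V1 : (1 < #|'rV[F]_n|)%N by rewrite card_rV -(exp1n n) ltn_exp2r.
set theta := sat_const / 2 * (N ^+ 2 * (w * w `^ c^-1)) in Hk.
have sat (A : {set 'rV[F]_n}) : w * N <= #|A|%:R ->
    exists u : R, [/\ w <= u, #|A|%:R = u * N &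
      2 * (sat_const / 2 * (N ^+ 2 * (u * u `^ c^-1))) <= #|triples (@ap_rel F n) A|%:R].
  move=> wA; exists (#|A|%:R / N); have uA : #|A|%:R = #|A|%:R / N * N.
    by rewrite divfK // gt_eqF.
  have wu : w <= #|A|%:R / N by rewrite ler_pdivlMr.
  have u0 : 0 < #|A|%:R / N by exact: lt_le_trans wu.
  split=> //; rewrite mulrA [2 * _]mulrC divfK //.
  apply: supersaturation => //.
    by rewrite ler_pdivrMr // mul1r ler_nat -card_rV max_card.
  apply: le_trans HN _; rewrite ler_pM2l // ler_pM2l //.
  by apply: ge0_ler_powR; rewrite ?nnegrE ?invr_ge0 ?(ltW c0) ?(ltW w0) ?(ltW u0).
have theta0 : 0 < theta by rewrite !mulr_gt0 ?powR_gt0 ?exprn_gt0.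
have wpos u : w <= u -> theta <= sat_const / 2 * (N ^+ 2 * (u * u `^ c^-1)).
  move=> wu; rewrite ler_pM2l ?divr_gt0 // ler_pM2l ?exprn_gt0 //.
  rewrite ler_pM ?(ltW w0) ?powR_ge0 //.
  by apply: ge0_ler_powR; rewrite ?nnegrE ?invr_ge0 ?(ltW c0) ?(ltW w0) // (le_trans (ltW w0)).
have step (A : {set 'rV[F]_n}) : theta < #|triples (@ap_rel F n) A|%:R ->
    (10 * #|A| ^ 3 < s ^ 2 * #|triples (@ap_rel F n) A|)%N /\
    (80 * #|A| ^ 2 <= s * #|triples (@ap_rel F n) A|)%N.
  move=> HA.
  have castE a b i : (a * b ^ i)%N%:R = a%:R * b%:R ^+ i :> R by rewrite natrM natrX.
  rewrite -(ltr_nat R) -(ler_nat R) 2!castE mulnC castE [(s * _)%N%:R]natrM [_ * s%:R ^+ 2]mulrC.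
  (* A set of density at least [w] gets its triples from supersaturation at its own density; a
     sparser one has more than [theta] by assumption, which is the bound at density [w]. *)
  have [wA|Aw] := leP (w * N) #|A|%:R.
    have [u [wu uA He]] := sat A wA.
    apply: (density_bounds invc_ge3 a0 N0 (lt_le_trans w0 wu) _ _ w0 wu) => //.
      by rewrite uA.
    apply: le_trans He; have := wpos u wu; lra.
  by apply: (density_bounds invc_ge3 a0 N0 w0 _ _ w0 (lexx w)) => //; apply: ltW.
have inj2 x y y' z := @ap_rel_inj2 n x y y' z two.
have [|Fam HF [P1 P2]] := iterated_family (@ap_rel_inj1 n) inj2 (@ap_rel_inj3 n)
  V1 step (k := k) (A := [set: 'rV[F]_n]%SET).
  by apply: le_trans Hk; rewrite ler_wpM2r ?exprn_ge0 ?divr_ge0 // card_triples_le.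
exists Fam; split; first by rewrite -card_rV.
  move=> C /P1 HC; rewrite ltNge; apply/negP => /sat[u [wu _ He]].
  by have := wpos u wu; lra.
move=> I apI; apply: P2; first exact: finset.subsetT.
exact: ap_free_indep.
Qed.

End SparseContainers.

(** * AP-free subsets of random sets *)

Lemma leq_exp_base m n e : (m <= n)%N -> (m ^ e <= n ^ e)%N.
Proof. by case: e => // e mn; rewrite leq_exp2r. Qed.

Lemma leq_bin_exp2 n m : ('C(n, m) <= 2 ^ n)%N.
Proof.
have [mn|nm] := leqP m n; last by rewrite bin_small.
rewrite -[2%N]/(1 + 1)%N expnDn (bigD1 (inord m)) //= inordK ?ltnS //.
by rewrite !exp1n !muln1 leq_addr.
Qed.

Lemma ffact_le_exp n m : (n ^_ m <= n ^ m)%N.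
Proof.
have -> : (n ^ m = \prod_(i < m) n)%N by rewrite prod_nat_const card_ord.
by rewrite ffact_prod; apply: leq_prod => i _; rewrite leq_subr.
Qed.

(** The falling factorial of [2m] has [m] factors, each at least [m]; it equals ['C(2m, m)] times
    the factorial of [m], and ['C(2m, m) <= 4 ^ m]. *)
Lemma self_exp_le_fact m : (m ^ m <= 4 ^ m * m`!)%N.
Proof.
apply: (@leq_trans ((2 * m) ^_ m)).
  have -> : (m ^ m = \prod_(i < m) m)%N by rewrite prod_nat_const card_ord.
  rewrite ffact_prod; apply: leq_prod => i _; have := ltn_ord i; lia.
by rewrite -bin_ffact leq_mul2r; apply/orP; right; rewrite -[4%N]/(2 ^ 2)%N -expnM leq_bin_exp2.
Qed.

Lemma bin_tail_le (R : realType) (a M : nat) (p : R) : (0 < M)%N -> 0 <= p ->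
  'C(a, M)%:R * p ^+ M <= (4 * (a%:R * p) / M%:R) ^+ M.
Proof.
move=> M0 p0.
have MR : 0 < M%:R :> R by rewrite ltr0n.
rewrite expr_div_n ler_pdivlMr ?exprn_gt0 // !exprMn mulrAC mulrA ler_wpM2r ?exprn_ge0 //.
rewrite -!natrX -!natrM ler_nat.
apply: (@leq_trans ('C(a, M) * (4 ^ M * M`!))).
  by rewrite leq_mul2l self_exp_le_fact orbT.
by rewrite mulnCA bin_ffact leq_mul2l ffact_le_exp orbT.
Qed.

Lemma f3_witness (V : finZmodType) (S : {set V}) :
  exists I : {set V}, [/\ I \subset S, ap_free 3 I & #|I| = f3 S].
Proof.
pose Q (I : {set V}) := (I \subset S) && ap_free 3 I.
have Q0 : Q finset.set0.
  rewrite /Q finset.sub0set; apply/forallP => x; apply/forallP => e; apply/implyP => _.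
  apply/negP => /fintype.subsetP/(_ x); rewrite inE => H.
  suff : false by [].
  by apply: H; apply/imsetP; exists ord0; rewrite // mulr0n addr0.
rewrite /max_ap_free (bigop.bigmax_eq_arg finset.set0) //.
by case: arg_maxnP => // I /andP[? ?] _; exists I.
Qed.

Lemma f3_le_card (V : finZmodType) (S : {set V}) : (f3 S <= #|S|)%N.
Proof. by have [I [IS _ <-]] := f3_witness S; apply: subset_leq_card. Qed.

(** Here [x - 2y + x = 0] for all [x] and [y], so two distinct points already form a nontrivial
    progression. *)
Lemma char2_ap_free (F : finFieldType) n (S : {set 'rV[F]_n}) :
  (2%:R : F) = 0 -> ap_free 3 S -> (#|S| <= 1)%N.
Proof.
move=> two apS; apply/card_le1P => x xS y; rewrite inE; apply/idP/eqP => [yS|->//].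
have H : x - y *+ 2 + x = 0.
  apply/rowP => l; rewrite mulr2n !mxE.
  by transitivity (2%:R * (x 0 l - y 0 l)); [ring | rewrite two mul0r].
by have := ap_free_eq apS xS yS xS; rewrite H eqxx => /esym/andP[_ /eqP].
Qed.

Section UnionBound.
Variables (R : realType) (V : finZmodType) (p : R) (mu : {set V} -> R).
Hypothesis p_ge0 : 0 <= p.
Hypothesis mu_ge0 : forall S, 0 <= mu S.
Hypothesis mu_superset : forall J : {set V},
  \sum_(S : {set V} | J \subset S) mu S = p ^+ #|J|.

(** [M] is the least integer above [x], so [f3 S > x] forces [S] to meet some container in at least
    [M] points. *)
Lemma container_union_bound (Fam : {set {set V}}) (x b : R) :
  0 <= x -> 0 <= b ->
  (forall I : {set V}, ap_free 3 I -> exists2 C, C \in Fam & I \subset C) ->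
  (forall C, C \in Fam -> 4 * (#|C|%:R * p) <= b * x) ->
  \sum_(S | ~~ ((f3 S)%:R <= x)) mu S <= #|Fam|%:R * b ^+ (Num.truncn x).+1.
Proof.
move=> x0 b0 Fcov Fsize; set M := (Num.truncn x).+1.
have xM : x < M%:R by exact: truncnS_gt.
apply: (@le_trans _ _ (\sum_(C in Fam) \sum_(S : {set V} | (M <= #|S :&: C|)%N) mu S)).
  rewrite (exchange_big_dep xpredT) //=.
  rewrite [leLHS]big_mkcond /=; apply: ler_sum => S _.
  case: ifP => [|_]; last by apply: sumr_ge0.
  rewrite -ltNge => xf; have [I [IS apI cI]] := f3_witness S.
  have [C CF IC] := Fcov I apI.
  rewrite (bigD1 C) /= ?lerDl ?sumr_ge0 // CF /=.
  have MI : (M <= #|I|)%N by rewrite cI truncn_lt_nat.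
  by apply: leq_trans MI _; apply: subset_leq_card; rewrite finset.subsetI IS.
rewrite mulr_natl -sumr_const; apply: ler_sum => C CF.
apply: le_trans (card_draws_superset mu_ge0 mu_superset C M) _.
apply: le_trans (bin_tail_le _ _ p_ge0) _ => //.
rewrite lerXn2r ?nnegrE ?divr_ge0 ?mulr_ge0 //.
rewrite ler_pdivrMr ?ltr0n //; apply: le_trans (Fsize C CF) _.
by rewrite ler_wpM2l // ltW.
Qed.

End UnionBound.

Section SparseRandomSets.
Variables (R : realType) (F : finFieldType) (beta t : R).
Let q := #|F|.
Let c := c_ R q.
Hypothesis beta_gt0 : 0 < beta.
Hypothesis t_lt : t < c * (1 - 2 * beta).

Let q_gt1 : (1 < q)%N. Proof. exact: finRing_gt1. Qed.
Let c0 : 0 < c. Proof. exact: c_gt0. Qed.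
Let c13 : c <= 1 / 3. Proof. exact: c_le. Qed.
Let r3 : 3 <= c^-1. Proof. exact: invc_ge3. Qed.

Local Notation pwq := (@pw R q).

Let tr_lt : t * c^-1 < 1 - 2 * beta.
Proof. by rewrite ltr_pdivrMr // mulrC. Qed.

Lemma exists_iterations : exists kq : nat, q%:R ^+ 3 <= (20 / 19 : R) ^+ kq.
Proof.
pose D : R := 19 * q%:R ^+ 3; pose k := (Num.truncn D).+1; exists k.
have Dk : D < k%:R by exact: truncnS_gt.
have : 1 + k%:R * (1 / 19) <= (1 + 1 / 19 : R) ^+ k.
  elim: (k) => [|j IH]; first by rewrite expr0 mul0r addr0.
  rewrite exprS -natr1; have j0 : 0 <= j%:R :> R by [].
  nra.
rewrite (_ : 1 + 1 / 19 = 20 / 19 :> R); last by field.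
by apply: le_trans; rewrite /D in Dk; lra.
Qed.

Section LargeDimension.
Variables (n kq : nat) (p : R).
Hypothesis two : (2%:R : F) != 0.
Hypothesis n_gt0 : (0 < n)%N.
Hypothesis Hkq : q%:R ^+ 3 <= (20 / 19 : R) ^+ kq.
Let a := sat_const R F.
Hypothesis n_large :
  (160 / a + 8 * q%:R * kq%:R + 16) * n.+1%:R ^+ 2 <= pwq n beta.
Hypothesis t_large : beta < t.
Hypothesis p_gt0 : 0 < p.
Hypothesis p_ge : pwq n (- (1 / 2) + t * c^-1 / 2) <= p.

Let a0 : 0 < a. Proof. exact: sat_const_gt0. Qed.
Let w := pwq n (- (t - beta)).
Let Q := p * pwq n (1 - t).

Let A0 : 0 <= 160 / a. Proof. by rewrite divr_ge0 // ltW. Qed.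
Let K0 : 0 <= 8 * q%:R * kq%:R :> R. Proof. by rewrite !mulr_ge0. Qed.

(** [n_large] bundles all demands on [N^beta]: [160 / a] for the container conditions, [8 q kq n^2]
    for the number of containers, 16 for their size, [n + 1] for the error. *)
Lemma pw_beta_ge x y : 0 <= x -> 0 <= y ->
  x <= 160 / a + 8 * q%:R * kq%:R + 16 -> y <= n.+1%:R ^+ 2 ->
  x * y <= pwq n beta.
Proof. by move=> *; apply: le_trans n_large; apply: ler_pM. Qed.

Lemma pw_beta_ge_succ : n.+1%:R <= pwq n beta.
Proof.
rewrite -[leLHS]mul1r; apply: pw_beta_ge => //; first by move: A0 K0; lra.
by rewrite -natrX ler_nat -mulnn leq_pmulr.
Qed.

Let n1 : 1 <= n.+1%:R ^+ 2 :> R.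
Proof. by rewrite -natrX ler1n expn_gt0. Qed.

Lemma pw_beta_ge_inv : 160 / a <= pwq n beta.
Proof. by rewrite -[leLHS]mulr1; apply: pw_beta_ge => //; move: A0 K0; lra. Qed.

Lemma pw_beta_ge16 : 16 <= pwq n beta.
Proof. by rewrite -[leLHS]mulr1; apply: pw_beta_ge => //; move: A0 K0; lra. Qed.

Lemma pw_beta_ge_sqr : 8 * q%:R * kq%:R * n%:R ^+ 2 <= pwq n beta.
Proof.
apply: pw_beta_ge; rewrite ?exprn_ge0 //; first by move: A0 K0; lra.
by rewrite lerXn2r ?nnegrE // ler_nat.
Qed.

Lemma Q_ge : pwq n (1 / 2 + t * c^-1 / 2 - t) <= Q.
Proof.
rewrite (_ : 1 / 2 + _ - t = (- (1 / 2) + t * c^-1 / 2) + (1 - t)); last first.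
  by move: (t * c^-1) => y; field.
by rewrite pwD // ler_wpM2r // ltW // pw_gt0.
Qed.

Let t0 : 0 < t. Proof. exact: lt_trans t_large. Qed.

Let tr3 : 3 * t <= t * c^-1.
Proof. by rewrite mulrC ler_wpM2l ?r3 // ltW. Qed.

Let br3 : 3 * beta <= beta * c^-1.
Proof. by rewrite mulrC ler_wpM2l ?r3 // ltW. Qed.

Lemma Q_ge1 : 1 <= Q.
Proof.
apply: le_trans Q_ge; apply: pw_ge1 => //.
by move: t0 tr3; move: (t * c^-1) => y; lra.
Qed.

(** Take [w = N^(beta - t)] and for [s] the least integer above [Q]. With [r = 1/c], the bound on
    [p] gives [s^2 w^(r-2) >= N^(1 + beta (r-2))], where [r >= 3] leaves a factor [N^beta]; the
    other density conditions follow from [t r < 1 - 2 beta]. *)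
Lemma large_family : exists (s : nat) (Fam : {set {set 'rV[F]_n}}),
  [/\ s%:R <= 2 * Q,
      (#|Fam| <= (q ^ n) ^ ((2 * s + 4) * (kq * n)))%N,
      forall C, C \in Fam -> #|C|%:R < pwq n (1 - t + beta) &
      forall I : {set 'rV[F]_n}, ap_free 3 I -> exists2 C, C \in Fam & I \subset C].
Proof.
have Q1 := Q_ge1; have Q0 : 0 <= Q by exact: le_trans Q1.
pose s := (Num.truncn Q).+1; have sQ : Q < s%:R by exact: truncnS_gt.
have s2Q : s%:R <= 2 * Q.
  have tQ : (Num.truncn Q)%:R <= Q by rewrite truncn_le.
  by rewrite /s -natr1; move: tQ Q1; lra.
exists s; have aB : 160 <= a * pwq n beta.
  by have := pw_beta_ge_inv; rewrite ler_pdivrMr // mulrC.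
have NE : (q ^ n)%:R = pwq n 1 by rewrite pw1.
have wE r : w `^ r = pwq n (- (t - beta) * r) by rewrite pw_powR.
have N0 : 0 < pwq n 1 by exact: pw_gt0.
have le_s x : pwq n x <= Q -> pwq n x <= s%:R by move=> /le_trans; apply; apply: ltW.
have [||||||Fam [HF1 HF2 HF3]] := @sparse_family R F n w s (kq * n) two n_gt0.
- exact: pw_gt0.
- rewrite -(pw0 R q n); apply: le_pw => //; move: t_large; lra.
- rewrite NE wE -pwD //; apply: le_trans (_ : 160 <= _); first lra.
  apply: le_trans aB _; rewrite ler_pM2l //; apply: le_pw => //.
  move: tr_lt br3 beta_gt0; rewrite -/c; move: (c^-1) => r; nra.
- rewrite NE wE; apply: (@lt_le_trans _ _ (80 * pwq n 1)).
    by rewrite ltr_pM2r //; lra.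
  apply: (@le_trans _ _ (a / 2 * (pwq n beta * pwq n 1))).
    by rewrite mulrA ler_pM2r //; lra.
  rewrite -/a [s%:R ^+ 2 * _]mulrC -[leRHS]mulrA ler_pM2l ?divr_gt0 //.
  apply: (@le_trans _ _ (pwq n (1 / 2 + t * c^-1 / 2 - t) ^+ 2 *
                         pwq n (- (t - beta) * (c^-1 - 2)))).
    rewrite expr2 -!pwD //; apply: le_pw => //.
    move: br3; rewrite -/c; move: (c^-1) => r; lra.
  apply: ler_wpM2r; first by apply/ltW/pw_gt0.
  apply: lerXn2r; rewrite ?nnegrE ?ler0n //; first by apply/ltW/pw_gt0.
  exact: le_s Q_ge.
- rewrite wE; apply: (@le_trans _ _ (a / 2 * pwq n beta)); first lra.
  rewrite -/a [s%:R * _]mulrC -[leRHS]mulrA ler_pM2l ?divr_gt0 //.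
  apply: (@le_trans _ _ (pwq n (1 / 2 + t * c^-1 / 2 - t) *
                         pwq n (- (t - beta) * (c^-1 - 1)))).
    rewrite -!pwD //; apply: le_pw => //.
    move: br3 tr_lt beta_gt0; rewrite -/c; move: (c^-1) => r; lra.
  by apply: ler_wpM2r; [apply/ltW/pw_gt0 | exact: le_s Q_ge].
- apply: (@le_trans _ _ 1).
    have b0 : 0 < 20 / 19 :> R by rewrite divr_gt0.
    rewrite (_ : 19 / 20 = (20 / 19)^-1 :> R); last by rewrite invf_div.
    rewrite exprVn ler_pdivrMr ?exprn_gt0 // mul1r natrX -exprM mulnC exprM.
    by rewrite [leRHS]exprM lerXn2r // nnegrE ?exprn_ge0 // ltW.
  apply: (@le_trans _ _ (a / 2 * pwq n beta)); first lra.
  rewrite ler_pM2l ?divr_gt0 // NE wE expr2 -!pwD //; apply: le_pw => //.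
  move: tr3 tr_lt br3 t_large beta_gt0; rewrite -/c; move: (c^-1) => r; lra.
exists Fam; split=> // C /HF2; rewrite NE -pwD //.
by rewrite (_ : - (t - beta) + 1 = 1 - t + beta) //; ring.
Qed.

(** For a container [C], [p |C| <= x / N^beta <= x / 16], so each tail is at most [4^-M]. The number
    of containers is at most [2^(Q N^beta) <= 2^M], and [2^-M <= 1/(n+1)] remains. *)
Lemma large_dimension_bad (mu : {set 'rV[F]_n} -> R) :
  (forall S, 0 <= mu S) ->
  (forall J : {set 'rV[F]_n}, \sum_(S : {set 'rV[F]_n} | J \subset S) mu S = p ^+ #|J|) ->
  \sum_(S | ~~ ((f3 S)%:R <= p * pwq n (1 - t + 2 * beta))) mu S <= n.+1%:R^-1.
Proof.
move=> mu0 muJ; have [s [Fam [sQ cardF sizeF covF]]] := large_family.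
set x := p * pwq n (1 - t + 2 * beta); pose M := (Num.truncn x).+1.
have B0 : 0 < pwq n beta by exact: pw_gt0.
have Q1 := Q_ge1; have Q0 : 0 < Q by exact: lt_le_trans Q1.
have BQx : Q * pwq n beta <= x.
  rewrite /Q /x -mulrA -pwD // ler_pM2l //; apply: le_pw => //.
  by move: beta_gt0; lra.
have x0 : 0 <= x by rewrite mulr_ge0 ?ltW // pw_gt0.
have xM : x < M%:R by exact: truncnS_gt.
have sizeF' C : C \in Fam -> 4 * (#|C|%:R * p) <= 1 / 4 * x.
  move=> /sizeF /ltW CF.
  have -> : x = p * pwq n (1 - t + beta) * pwq n beta.
    by rewrite -mulrA -pwD // (_ : 1 - t + beta + beta = 1 - t + 2 * beta) //; ring.
  have H1 : #|C|%:R * p <= p * pwq n (1 - t + beta) by rewrite mulrC ler_pM2l.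
  have H2 : 0 <= p * pwq n (1 - t + beta) by apply: le_trans H1; rewrite mulr_ge0 // ltW.
  have H3 := ler_wpM2l H2 pw_beta_ge16.
  by move: H1 H3; lra.
have b0 : 0 <= 1 / 4 :> R by rewrite divr_ge0.
apply: le_trans (container_union_bound (ltW p_gt0) mu0 muJ x0 b0 covF sizeF') _.
rewrite -/M; have nM : (n < M)%N.
  rewrite -(ltr_nat R); apply: le_lt_trans xM; apply: le_trans BQx.
  by apply: le_trans (le_trans _ pw_beta_ge_succ) _; rewrite ?ler_nat ?ler_peMl // ltW.
have FM : (#|Fam| <= 2 ^ M)%N.
  apply: leq_trans cardF _; apply: (@leq_trans ((2 ^ q) ^ (n * ((2 * s + 4) * (kq * n))))).
    by rewrite -expnM; apply: leq_exp_base; apply: ltnW; apply: ltn_expl.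
  rewrite -expnM leq_exp2l // -(ler_nat R); apply/ltW/(le_lt_trans _ xM).
  apply: le_trans BQx; apply: (@le_trans _ _ (Q * (8 * q%:R * kq%:R * n%:R ^+ 2))); last first.
    by rewrite ler_pM2l // pw_beta_ge_sqr.
  have -> : (q * (n * ((2 * s + 4) * (kq * n))))%:R =
     (2 * s%:R + 4) * (q%:R * kq%:R * n%:R ^+ 2) :> R by rewrite !natrM natrD natrM; ring.
  have -> : Q * (8 * q%:R * kq%:R * n%:R ^+ 2) = (8 * Q) * (q%:R * kq%:R * n%:R ^+ 2) by ring.
  by rewrite ler_wpM2r ?mulr_ge0 //; move: sQ Q1; lra.
apply: (@le_trans _ _ ((2 ^ M)%:R * (1 / 4) ^+ M)).
  by rewrite ler_wpM2r ?exprn_ge0 // ler_nat.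
rewrite natrX -exprMn (_ : 2 * (1 / 4) = 2^-1 :> R); last by field.
rewrite exprVn lef_pV2 ?posrE ?exprn_gt0 // -natrX ler_nat.
by apply: leq_trans nM _; apply/ltnW/ltn_expl.
Qed.

End LargeDimension.

Lemma eventually_bad_small : exists n0 : nat, forall (n : nat) (p : R)
    (mu : {set 'rV[F]_n} -> R), (n0 <= n)%N -> (0 < n)%N -> 0 < p ->
  pwq n (- (1 / 2) + t * c^-1 / 2) <= p ->
  (forall S, 0 <= mu S) ->
  (forall J : {set 'rV[F]_n}, \sum_(S : {set 'rV[F]_n} | J \subset S) mu S = p ^+ #|J|) ->
  \sum_(S | ~~ ((f3 S)%:R <= p * pwq n (1 - t + 2 * beta))) mu S <= n.+1%:R^-1.
Proof.
have [kq Hkq] := exists_iterations.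
have [n0 Hn0] := pw_eventually_ge q_gt1
  (160 / sat_const R F + 8 * q%:R * kq%:R + 16) beta_gt0.
exists n0 => n p mu n0n n_gt0 p0 p_ge mu0 muJ; have n_large := Hn0 n n0n.
(* For [t <= beta] the target exceeds the mean [p N] by at least [N^beta], and Markov's inequality
   suffices. *)
have [tb|bt] := leP t beta.
  have x0 : 0 < p * pwq n (1 - t + 2 * beta) by rewrite mulr_gt0 // pw_gt0.
  apply: le_trans (_ : _ <= _) (le_trans (markov_card mu0 muJ x0) _).
    rewrite big_mkcond [leRHS]big_mkcond /=; apply: ler_sum => S _.
    case: ifP => [|_]; last by case: ifP.
    rewrite -ltNge => xf; rewrite ifT //; apply: lt_le_trans xf _.
    by rewrite ler_nat f3_le_card.
  rewrite card_rV -(pw1 R) // invfM mulrA mulfK ?gt_eqF // -pwN -pwD //.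
  apply: (@le_trans _ _ (pwq n (- beta))); first by apply: le_pw => //; lra.
  rewrite pwN lef_pV2 ?posrE ?pw_gt0 //.
  exact: (pw_beta_ge_succ n_large).
(* In characteristic 2, [f3 S <= 1] while the target is at least 1. *)
have [two|two] := eqVneq (2%:R : F) 0; last first.
  exact: large_dimension_bad Hkq n_large bt p0 p_ge _ mu0 muJ.
rewrite big1 // => S; rewrite -ltNge => xf; exfalso.
have [I [_ apI cI]] := f3_witness S.
have : (f3 S)%:R <= 1 :> R by rewrite lern1 -cI char2_ap_free.
rewrite leNgt => /negP; apply; apply: le_lt_trans xf.
apply: le_trans (Q_ge1 bt p_ge) _; rewrite ler_pM2l //; apply: le_pw => //.
by move: beta_gt0; lra.
Qed.

End SparseRandomSets.

(** * Transfer to probabilities and the two statements *)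

Local Open Scope classical_set_scope.
Local Open Scope ring_scope.

(** The error is fixed before [p] and the probability space, so it is uniform in them. The value 1
    below [n0] makes the claim trivial there; the 2 leaves room for two exceptional events. *)
Lemma exists_error (R : realType) (n0 : nat) : exists2 err : nat -> R,
  err @ \oo --> (0 : R) &
  forall n (m : R), 0 <= m -> ((n0 <= n)%N -> 1 - 2 / n.+1%:R <= m) -> 1 - err n <= m.
Proof.
exists (fun n => if (n < n0)%N then 1 else 2 / n.+1%:R).
  have H2 : (fun n => 2 * harmonic n : R) @ \oo --> (0 : R).
    rewrite -(mulr0 2); apply: cvgM; [exact: cvg_cst | exact: cvg_harmonic].
  apply: cvg_trans H2; apply: near_eq_cvg; near=> n; rewrite ltnNge.
  by have -> : (n0 <= n)%N by near: n; exact: nbhs_infty_ge.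
by move=> n m m0 H; case: ltnP => [_|/H //]; rewrite subrr.
Unshelve. all: by end_near.
Qed.

Lemma prob_compl (R : realType) (d : measure_display) (T : measurableType d)
    (P : probability T R) (V : finType) (p : R) (B : T -> {set V})
    (Q : pred {set V}) : binomial_random_subset P p B ->
  P [set w | Q (B w)] = (1 - \sum_(S | ~~ Q S) law P B S)%:E.
Proof.
move=> HB; rewrite (prob_law HB) -(law_sum1 HB) [in RHS](bigID Q) /=.
by rewrite addrK.
Qed.

Lemma random_subset_prob_le1 (R : realType) (d : measure_display) (T : measurableType d)
    (P : probability T R) (V : finType) (x : V) (p : R) (B : T -> {set V}) :
  binomial_random_subset P p B -> p <= 1.
Proof.
by case=> mB pB _; rewrite -lee_fin -(pB x); apply: probability_le1.
Qed.

(** Since [1/2 + eps <= 1], one has [1/2 + eps - delta <= (1/2 + eps)(1 - delta)]. Replacing the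
    mean [m] by [2v] then costs [2^(1 - delta) <= 2]. *)
Lemma sparse_ap_free_powR_le (R : realType) (q n v : nat) (f eps delta : R) :
  (1 < q)%N -> 0 < eps -> eps <= 1 / 2 -> 0 < delta -> delta < 1 ->
  pw q n (1 / 2 + eps) / 2 <= v%:R ->
  f <= pw q n (- (1 / 2) + eps) * pw q n (1 - delta) ->
  f <= 2 * v%:R `^ (1 - delta).
Proof.
move=> q1 e0 e1 d0 d1 Hv Hf; set m := pw q n (1 / 2 + eps) in Hv.
have m0 : 0 < m by exact: pw_gt0.
apply: le_trans Hf _; apply: (@le_trans _ _ (m `^ (1 - delta))).
  by rewrite pw_powR -pwD //; apply: le_pw => //; nra.
apply: (@le_trans _ _ ((2 * v%:R) `^ (1 - delta))).
  by apply: ge0_ler_powR; rewrite ?nnegrE ?subr_ge0 ?mulr_ge0 ?(ltW m0) ?(ltW d1) //; lra.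
rewrite powRM // ler_wpM2r ?powR_ge0 //.
by apply: ler1_powR; lra.
Qed.

Theorem theorem1p2 (R : realType) :
  (exists2 K : R, 0 < K &
    forall (F : finFieldType) (beta t : R),
      let q : R := #|F|%:R in
      0 < beta ->
      t < c_ R #|F| * (1 - 2 * beta) ->
      exists2 err : nat -> R, err @ \oo --> (0 : R) &
        forall (n : nat) (p : R),
          (0 < n)%N -> 0 < p ->
          q `^ (n%:R * (- (1 / 2) + t * (C_ R #|F| - 1) / 2)) <= p ->
          p <= 1 ->
          forall (d : measure_display) (T : measurableType d)
                 (P : probability T R) (B : T -> {set 'rV[F]_n}),
            binomial_random_subset P p B ->
            ((1 - err n)%:E <=
               P [set w | ((f3 (B w))%:R
                           <= K * (p * q `^ (n%:R * (1 - t + 2 * beta))))%R])%E)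
  /\
  (exists2 K : R, 0 < K &
    forall (F : finFieldType) (eps : R),
      let q : R := #|F|%:R in
      0 < eps ->
      exists2 delta : R, 0 < delta &
        exists2 err : nat -> R, err @ \oo --> (0 : R) &
          forall n : nat,
            (0 < n)%N ->
            forall (d : measure_display) (T : measurableType d)
                   (P : probability T R) (B : T -> {set 'rV[F]_n}),
              binomial_random_subset P (q `^ (n%:R * (- (1 / 2) + eps))) B ->
              ((1 - err n)%:E <=
                 P [set w | ((f3 (B w))%:R
                             <= K * #|B w|%:R `^ (1 - delta))%R])%E).
Proof.
split.
  exists 1 => // F beta t q beta0 t_lt.
  have [n0 Hn0] := eventually_bad_small beta0 t_lt.
  have [err err0 Herr] := exists_error R n0.
  exists err => // n p n_gt0 p0 p_ge _ d T P B HB.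
  rewrite mul1r; set x := p * _.
  have PE := prob_compl (fun S => (f3 S)%:R <= x) HB.
  rewrite PE lee_fin; apply: Herr => [|n0n].
    by rewrite -lee_fin -PE; apply: measure_ge0.
  have bad : \sum_(S | ~~ ((f3 S)%:R <= x)) law P B S <= n.+1%:R^-1.
    apply: (Hn0 n p (law P B)) => //; last exact: law_superset HB.
    - by move: p_ge; rewrite /C_ [1 + _]addrC addrK.
    - exact: law_ge0.
  rewrite lerD2l lerN2; apply: le_trans bad _.
  by rewrite ler_peMl ?invr_ge0 // ler1n.
exists 2 => // F eps q eps0.
have q1 : (1 < #|F|)%N by exact: finRing_gt1.
have c0 : 0 < c_ R #|F| by exact: c_gt0.
have c13 : c_ R #|F| <= 1 / 3 by exact: c_le.
(* For [eps > 1/2] the inclusion probability would exceed 1, so no such random set exists. *)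
have [eps1|eps1] := leP eps (1 / 2); last first.
  exists 1 => //; exists (fun=> 0); first exact: cvg_cst.
  move=> n n_gt0 d T P B HB.
  have := random_subset_prob_le1 (0 : 'rV[F]_n) HB; rewrite leNgt => /negP[].
  rewrite /powR gt_eqF ?ltr0n ?(ltnW q1) // expR_gt1 mulr_gt0 ?ln_gt0 ?ltr1n //.
  by rewrite mulr_gt0 ?ltr0n //; move: eps1; lra.
(* With [t = c eps] the first part asks only for [p >= N^(-1/2 + eps/2)], and
   [1 - t + 2 beta = 1 - delta]. *)
pose t := c_ R #|F| * eps; pose beta := t / 4; pose delta := t / 2.
have t0 : 0 < t by rewrite mulr_gt0.
have t1 : t <= 1 / 6 by rewrite /t; nra.
have beta0 : 0 < beta by rewrite divr_gt0.
have t_lt : t < c_ R #|F| * (1 - 2 * beta).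
  by rewrite /t ltr_pM2l // /beta; move: t1 eps1; lra.
have delta0 : 0 < delta by rewrite divr_gt0.
have [n0 Hn0] := eventually_bad_small beta0 t_lt.
have [n1 Hn1] := @pw_eventually_ge R _ q1 (1 / 2) 4 ltac:(by rewrite divr_gt0).
have [err err0 Herr] := exists_error R (maxn n0 n1).
exists delta => //; exists err => // n n_gt0 d T P B HB.
set p := q `^ _ in HB; have p0 : 0 < p by rewrite powR_gt0 // ltr0n ltnW.
have PE := prob_compl (fun S => (f3 S)%:R <= 2 * #|S|%:R `^ (1 - delta)) HB.
rewrite PE lee_fin; apply: Herr => [|n0n].
  by rewrite -lee_fin -PE; apply: measure_ge0.
have [n0n' n1n] : (n0 <= n)%N /\ (n1 <= n)%N.
  by move: n0n; rewrite geq_max => /andP.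
have mE : #|'rV[F]_n|%:R * p = pw #|F| n (1 / 2 + eps).
  rewrite card_rV -(pw1 R) // -[p]/(pw #|F| n (- (1 / 2) + eps)) -pwD //.
  by congr pw; lra.
have m0 : 0 < #|'rV[F]_n|%:R * p by rewrite mE pw_gt0.
have bad1 : \sum_(S | ~~ ((f3 S)%:R <= p * pw #|F| n (1 - t + 2 * beta))) law P B S
    <= n.+1%:R^-1.
  apply: (Hn0 n p (law P B)) => //; last exact: law_superset HB.
  - rewrite -/p; apply: le_pw => //; rewrite /t [c_ R _ * eps]mulrC mulfK ?gt_eqF //.
    by move: eps0; lra.
  - exact: law_ge0.
(* The mean [m] satisfies [m >= N^(1/2) >= 4 (n+1)^2] by the choice of [n1], so
   [4 / m <= 1/(n+1)]. *)
have bad2 : \sum_(S : {set 'rV[F]_n} | #|S|%:R < #|'rV[F]_n|%:R * p / 2) law P B S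
    <= n.+1%:R^-1.
  apply: le_trans (chebyshev_card (law_ge0 P B) (law_sum1 HB) (law_superset HB) m0) _.
  rewrite mE ler_pdivrMr ?pw_gt0 // ler_pdivlMl //.
  apply: le_trans (_ : 4 * n.+1%:R ^+ 2 <= _).
    by rewrite mulrC ler_pM2l // ler_peMr // ler1n.
  by apply: le_trans (Hn1 n n1n) _; apply: le_pw => //; move: eps0; lra.
have bad : \sum_(S | ~~ ((f3 S)%:R <= 2 * #|S|%:R `^ (1 - delta))) law P B S
    <= n.+1%:R^-1 + n.+1%:R^-1.
  apply: le_trans (lerD bad1 bad2).
  rewrite [leLHS]big_mkcond [X in _ <= X + _]big_mkcond [X in _ <= _ + X]big_mkcond.
  rewrite -big_split /=; apply: ler_sum => S _; have l0 := law_ge0 P B S.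
  case: ifP => H; last by rewrite addr_ge0 //; case: ifP.
  case: ifP => H1; first by rewrite lerDl; case: ifP.
  rewrite add0r; case: ifP => // H2; case/negP: H.
  apply: (sparse_ap_free_powR_le (n := n) q1 eps0 eps1 delta0).
  - by rewrite /delta; move: t1; lra.
  - by rewrite -mE leNgt H2.
  - move/negbFE: H1; rewrite (_ : 1 - t + 2 * beta = 1 - delta) //.
    by rewrite /delta /beta; field.
by rewrite lerD2l lerN2; apply: le_trans bad _; rewrite mulr_natl mulr2n.
Qed.
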